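(* Let $n,K\ge1$ be integers, let $\mathbf F^*\in\mathbb R^{K\times n}$ be deterministic, let $\boldsymbol\xi$ be a $K\times n$ random matrix and let $\mathbf Y=\mathbf F^*+\boldsymbol\xi$. Let $\mathcal F$ be a measurable set of real $K\times n$ matrices, $\pi_0$ a probability measure on $\mathcal F$, $\tau>0$, and let $\widehat{\mathbf F}^{\rm EWA}=\int_{\mathcal F}\mathbf F\,\pi_n(d\mathbf F)$ be the exponentially weighted aggregate with prior $\pi_0$ and temperature $\tau$. Assume that for some $K\times K$ positive semidefinite matrix $\boldsymbol\Sigma$ we have $\boldsymbol\xi=\boldsymbol\Sigma^{1/2}\bar{\boldsymbol\xi}$, where the $K\times n$ random matrix $\bar{\boldsymbol\xi}$ has independent rows $\bar{\boldsymbol\xi}_{j\bullet}=[\bar\xi_{j,1},\ldots,\bar\xi_{j,n}]$, $j\in[K]$, satisfying, for some constant $\bar B_\xi>0$: (i) for any $(i,j)\in[n]\times[K]$, $\mathbf P(|\bar\xi_{j,i}|\le\bar B_\xi)=1$; (ii) for any $j\in[K]$ and any sign vector $\boldsymbol s\in\{\pm1\}^n$, $[s_1\bar\xi_{j,1},\ldots,s_n\bar\xi_{j,n}]$ has the same distribution as $\bar{\boldsymbol\xi}_{j\bullet}$. In addition, assume that for some $\bar L>0$, $\max_{i\in[n]}\|\boldsymbol\Sigma^{1/2}(\mathbf F_i-\mathbf F'_i)\|_\infty\le\bar L$ for every $\mathbf F,\mathbf F'\in\mathcal F$. Then, for every $\tau\ge\frac1n\bar B_\xi\max(2\bar L,\,3\|\boldsymbol\Sigma\|\bar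 B_\xi)$, $$\mathbf E[\ell_n(\widehat{\mathbf F}^{\rm EWA},\mathbf F^* )]\le\inf_p\bigg\{\int_{\mathcal F}\ell_n(\mathbf F,\mathbf F^* )\,p(d\mathbf F)+2\tau D_{\rm KL}(p\,\|\,\pi_0)\bigg\},$$ where the infimum is over all probability measures $p$ on $\mathcal F$. Furthermore, for every $\tau\ge\frac1n\bar B_\xi\max(2\bar L,\,6\|\boldsymbol\Sigma\|\bar B_\xi)$, with $\widehat{\mathbf F}=\widehat{\mathbf F}^{\rm EWA}$, $$\mathbf E[\ell_n(\widehat{\mathbf F},\mathbf F^* )]\le\inf_p\bigg\{\int_{\mathcal F}\ell_n(\mathbf F,\mathbf F^* )\,p(d\mathbf F)+2\tau D_{\rm KL}(p\,\|\,\pi_0)\bigg\}-\frac12\,\mathbf E\bigg[\int_{\mathcal F}\ell_n(\widehat{\mathbf F},\mathbf F)\,\pi_n(d\mathbf F)\bigg].$$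
   Context: Notation: $[n]=\{1,\ldots,n\}$; $\mathbf F_i\in\mathbb R^K$ denotes the $i$-th column of a $K\times n$ matrix $\mathbf F$; $\|\boldsymbol u\|_\infty=\max_j|u_j|$ for a vector; $\|\cdot\|_2$ is the Euclidean norm, $\|\cdot\|_F$ the Frobenius norm, and $\|\boldsymbol\Sigma\|$ the spectral norm of a matrix $\boldsymbol\Sigma$. The empirical loss is $\ell_n(\mathbf F,\mathbf G)=\frac1n\|\mathbf F-\mathbf G\|_F^2=\frac1n\sum_{i\in[n]}\|\mathbf F_i-\mathbf G_i\|_2^2$. The tempered posterior $\pi_n$ (a random probability measure on $\mathcal F$, depending on $\mathbf Y$) is defined by $$\pi_n(d\mathbf F)\propto \exp\Big\{-\frac1{2\tau}\ell_n(\mathbf F,\mathbf Y)\Big\}\,\pi_0(d\mathbf F),$$ and $\widehat{\mathbf F}^{\rm EWA}=\int_{\mathcal F}\mathbf F\,\pi_n(d\mathbf F)$. $D_{\rm KL}(p\,\|\,\pi_0)$ is the Kullback–Leibler divergence, equal to $\int\log\frac{dp}{d\pi_0}\,dp$ if $p\ll\pi_0$ and $+\infty$ otherwise. *)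

(* Defs.v *)
From HB Require Import structures.
From mathcomp Require Import all_boot all_order all_algebra.
From mathcomp Require Import all_classical all_reals all_analysis.
From mathcomp Require Import measurable_realfun.

Set Implicit Arguments.
Unset Strict Implicit.
Unset Printing Implicit Defensive.

Import Order.TTheory GRing.Theory Num.Theory.
Import numFieldNormedType.Exports.

Local Open Scope classical_set_scope.
Local Open Scope ring_scope.

(* The sigma-algebra on matrices is the product one, generated by the entries;
   over a realType it is the Borel sigma-algebra. *)
Definition measure_matrix_display : measure_display -> measure_display.
Proof. exact. Qed.

Section measurable_matrix.
Context {d} {T : measurableType d} {m n : nat}.

Definition mx_entries_measurable : set (set 'M[T]_(m, n)) :=
  <<s [set A | exists i j (B : set T),
         measurable B /\ A = (fun M : 'M[T]_(m, n) => M i j) @^-1` B] >>.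

Let mx_set0 : mx_entries_measurable set0.
Proof. exact: sigma_algebra0. Qed.

Let mx_setC A : mx_entries_measurable A -> mx_entries_measurable (~` A).
Proof. exact: sigma_algebraC. Qed.

Let mx_bigcup (F : (set 'M[T]_(m, n))^nat) :
  (forall i, mx_entries_measurable (F i)) ->
  mx_entries_measurable (\bigcup_i (F i)).
Proof. exact: sigma_algebra_bigcup. Qed.

HB.instance Definition _ := @isMeasurable.Build (measure_matrix_display d)
  'M[T]_(m, n) mx_entries_measurable mx_set0 mx_setC mx_bigcup.

Lemma measurable_mx_entry i j :
  measurable_fun [set: 'M[T]_(m, n)] (fun M : 'M[T]_(m, n) => M i j).
Proof.
move=> _ B mB; rewrite setTI; apply: sub_sigma_algebra.
by exists i, j, B.
Qed.

End measurable_matrix.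

Section linear_algebra.
Context {R : realType}.

(* Frobenius norm; on column vectors it is the Euclidean norm. *)
Definition frob_norm m n (A : 'M[R]_(m, n)) : R :=
  Num.sqrt (\sum_i \sum_j A i j ^+ 2).

Definition spectral_norm m n (A : 'M[R]_(m, n)) : R :=
  sup [set frob_norm (A *m u) | u in [set u : 'cV[R]_n | frob_norm u <= 1]].

Definition psdmx n (A : 'M[R]_n) : Prop :=
  A^T = A /\ forall u : 'cV[R]_n, 0 <= (u^T *m A *m u) 0 0.

(* The positive semidefinite square root, unique when A is positive
   semidefinite; the default value 0 is reached only for other matrices A. *)
Definition sqrtmx n (A : 'M[R]_n) : 'M[R]_n :=
  xget 0 [set S : 'M[R]_n | psdmx S /\ S *m S = A].

Definition ell K n (F G : 'M[R]_(K, n)) : R :=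
  n%:R^-1 * frob_norm (F - G) ^+ 2.

End linear_algebra.

Section probability_notions.
Context {R : realType} {d d'} {T : measurableType d} {T' : measurableType d'}.

Definition mutually_independent (P : probability T R) (I : finType)
    (X : I -> T -> T') : Prop :=
  forall (J : {set I}) (A : I -> set T'), (forall i, measurable (A i)) ->
  P (\bigcap_(i in [set` J]) (X i @^-1` A i)) =
  (\prod_(i in J) P (X i @^-1` A i))%E.

Definition same_distribution (P : probability T R) (X Y : T -> T') : Prop :=
  forall A, measurable A -> pushforward P X A = pushforward P Y A.

End probability_notions.

Definition KL {R : realType} {d} {T : measurableType d}
    (p q : probability T R) : \bar R :=
  if `[< p `<< q >]
  then (\int[p]_x lne (Radon_Nikodym (charge_of_finite_measure p) q x))%E
  else +oo%E.

Section gibbs_posterior.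
Context {R : realType} {K n : nat}.
Variables (pi0 : probability 'M[R]_(K, n) R) (tau : R) (Y : 'M[R]_(K, n)).

Definition gibbs_density (F : 'M[R]_(K, n)) : R :=
  expR (- ((2 * tau)^-1 * ell F Y)).

Definition gibbs_weight (A : set 'M[R]_(K, n)) : \bar R :=
  (\int[pi0]_(F in A) (gibbs_density F)%:E)%E.

Lemma measurable_gibbs_density : measurable_fun setT gibbs_density.
Proof.
have -> : gibbs_density = (fun F => expR (- ((2 * tau)^-1 *
    (n%:R^-1 * \sum_i \sum_j (F i j - Y i j) ^+ 2)))).
  apply/funext => F; rewrite /gibbs_density /ell /frob_norm sqr_sqrtr; last first.
    by do 2 (apply: sumr_ge0 => ? _); exact: sqr_ge0.
  do 4 f_equal; apply: eq_bigr => i _; apply: eq_bigr => j _.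
  by rewrite !mxE.
apply: measurableT_comp => //; apply: measurable_funN.
do 2 apply: measurable_funM => //.
do 2 (apply: measurable_sum => ?).
by apply: measurable_funX; apply: measurable_funB => //; exact: measurable_mx_entry.
Qed.

Let gibbs0 : gibbs_weight set0 = 0%E.
Proof. by rewrite /gibbs_weight integral_set0. Qed.

Let gibbs_ge0 A : (0 <= gibbs_weight A)%E.
Proof. by apply: integral_ge0 => F _; rewrite lee_fin expR_ge0. Qed.

Let gibbs_sigma_additive : semi_sigma_additive gibbs_weight.
Proof.
move=> A mA tA mUA; rewrite /gibbs_weight ge0_integral_bigcup//=.
- apply: is_cvg_ereal_nneg_natsum_cond => k _ _.
  by apply: integral_ge0 => F _; rewrite lee_fin expR_ge0.
- apply/measurable_EFinP; apply: measurable_funTS.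
  exact: measurable_gibbs_density.
- by move=> F _; rewrite lee_fin expR_ge0.
Qed.

HB.instance Definition _ := isMeasure.Build _ _ _ gibbs_weight
  gibbs0 gibbs_ge0 gibbs_sigma_additive.

(* mnormalize falls back on its second argument only when the total mass is 0
   or +oo, which does not happen here: for tau > 0 it lies in ]0, 1]. *)
Definition gibbs : probability 'M[R]_(K, n) R := mnormalize gibbs_weight pi0.

(* Entrywise integral of F under the tempered posterior. *)
Definition EWA (calF : set 'M[R]_(K, n)) : 'M[R]_(K, n) :=
  \matrix_(j, i) \int[gibbs]_(F in calF) (F j i).

End gibbs_posterior.

(* A probability measure on calF is encoded as a probability on all matrices
   that gives mass 1 to calF. *)
Definition oracle_risk {R : realType} {K n : nat} (calF : set 'M[R]_(K, n))
    (pi0 : probability 'M[R]_(K, n) R) (tau : R) (Fstar : 'M[R]_(K, n)) :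
    \bar R :=
  ereal_inf [set (\int[p]_(F in calF) (ell F Fstar)%:E
                  + (2 * tau)%:E * KL p pi0)%E
            | p in [set p : probability 'M[R]_(K, n) R | p calF = 1%E]].

(* Main.v *)
(* Let Z(Y) be the mass of the tempered prior, Fhat the EWA and V(Y) the posterior
   mean of ell Fhat.  Convexity and the Donsker-Varadhan formula give, for every p,
     ell Fhat Y + V(Y) <= - 2 tau ln Z(Y) <= \int ell F Y dp + 2 tau KL p pi0.
   Expanding ell around Fstar, the terms quadratic in the noise xi cancel:
     ell Fhat Fstar + V(Y) <= \int ell F Fstar dp + 2 tau KL p pi0
                              + (2 / n) <xi, Fhat - mean p>.
   Write <xi, Fhat> as the sum over the entries of xibar_ji (S Fhat)_ji, S being
   the square root of Sigma.  Replacing xibar_ji by 0 in the data tilts the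
   posterior by the exponential of a multiple of (S F)_ji, whose oscillation is at
   most L; since B L / (tau n) <= 1 / 2, the mean of (S F)_ji moves by at most
   3 / 2 times |xibar_ji| / (tau n) times its posterior variance, and these
   variances sum to at most ||Sigma|| n V(Y).  After this replacement the summand
   is odd in xibar_ji, so it has expectation 0, because independence of the rows
   and symmetry within a row make the law of xibar invariant under flipping the
   sign of one entry. *)
From HB Require Import structures.
Require Import Defs.
From mathcomp Require Import all_boot all_order all_algebra.
From mathcomp Require Import all_classical all_reals all_analysis.
From mathcomp Require Import measurable_realfun ring lra.
Import Order.TTheory GRing.Theory Num.Theory.
Import numFieldNormedType.Exports.
Local Open Scope classical_set_scope.
Local Open Scope ring_scope.

(** * Integrals against probability measures *)

(** The noise is only symmetric and bounded, and entries of one row may be dependent, so no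
    integration by parts removes the correlation between the noise and the estimator; comparing each
    entry with 0 is the substitute, and its price is the tilting error. The constants multiply up as
    follows: the expansion of the loss contributes [2 / n], the tilt [3 / 2 * B^2 / (tau n)], and
    the sum of the variances [||Sigma|| n V(Y)]. Hence [V(Y)] keeps the coefficient
    [1 - 3 B^2 ||Sigma|| / (tau n)], which is nonnegative under the first condition on [tau] and at
    least [1 / 2] under the second. A further obstacle is that [calF] may be unbounded: the diameter
    condition only concerns its image under [S], which may be singular. Second moments of the
    posterior, and bounds uniform over bounded data that allow expectations to be taken, are
    therefore extracted from the exponential weight itself, through [- 2 tau ln Z(Y)]. *)

Section probability_integrals.
Context {R : realType} {d} {T : measurableType d}.

(** Change of variables is known for the Radon-Nikodym derivative; [h] agrees with it almost
    everywhere because both have the same integral over every measurable set. *)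
Lemma integral_dens (mu nu : probability T R) (h : T -> R) D (f : T -> \bar R) :
  measurable_fun setT h -> (forall x, 0 <= h x) ->
  (forall A, measurable A -> nu A = \int[mu]_(x in A) (h x)%:E)%E ->
  measurable D -> measurable_fun setT f -> (forall x, 0 <= f x)%E ->
  (\int[nu]_(x in D) f x = \int[mu]_(x in D) (f x * (h x)%:E))%E.
Proof.
move=> mh h0 nuE mD mf f0.
have numu : nu `<< mu.
  apply/null_content_dominatesP => A mA muA; rewrite nuE//.
  apply: null_set_integral => //.
  by apply/measurable_EFinP; exact: measurable_funTS.
pose g := Radon_Nikodym_SigmaFinite.f nu mu.
have mg : measurable_fun setT g.
  exact: (measurable_int mu (Radon_Nikodym_SigmaFinite.f_integrable numu)).
have gh : ae_eq mu setT g (EFin \o h).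
  apply: integral_ae_eq => //.
  - exact: Radon_Nikodym_SigmaFinite.f_integrable.
  - exact/measurable_EFinP.
  - by move=> A _ mA; rewrite -Radon_Nikodym_SigmaFinite.f_integral//; exact: nuE.
rewrite -(Radon_Nikodym_SigmaFinite.change_of_variables numu f0 mD)//; last first.
  exact: measurable_funTS.
apply: ge0_ae_eq_integral => //.
- by apply: emeasurable_funM; exact: measurable_funTS.
- apply: emeasurable_funM; apply: measurable_funTS => //.
  exact/measurable_EFinP.
- by move=> x _; rewrite mule_ge0 ?Radon_Nikodym_SigmaFinite.f_ge0.
- by move=> x _; rewrite mule_ge0 ?lee_fin.
- by apply: (filterS _ gh) => x /= /(_ Logic.I) + _; rewrite -/g => ->.
Qed.

Lemma integral_prob1 (P : probability T R) D (f : T -> \bar R) :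
  measurable D -> P D = 1%E -> measurable_fun setT f ->
  (\int[P]_(x in D) f x = \int[P]_x f x)%E.
Proof.
move=> mD PD mf.
have PDC : P (~` D) = 0%E by rewrite probability_setC// PD subee.
rewrite [RHS]integralE [LHS]integralE; congr (_ - _)%E.
  rewrite [RHS](@ge0_negligible_integral _ _ _ _ _ (~` D)) ?setTD ?setCK//.
  - exact: measurableC.
  - exact: measurable_funepos.
rewrite [RHS](@ge0_negligible_integral _ _ _ _ _ (~` D)) ?setTD ?setCK//.
- exact: measurableC.
- exact: measurable_funeneg.
Qed.

Lemma integrable_fin_prob (P : probability T R) D (f : T -> R) (C : R) :
  measurable D -> measurable_fun setT f -> (forall x, D x -> `|f x| <= C) ->
  P.-integrable D (EFin \o f).
Proof.
move=> mD mf fC; apply: (@le_integrable _ _ _ _ _ mD _ (EFin \o cst C)).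
- by apply/measurable_EFinP; exact: measurable_funTS.
- by move=> x Dx /=; rewrite lee_fin (le_trans (fC _ Dx))// ler_norm.
- exact: finite_measure_integrable_cst.
Qed.

Lemma integral_expRN (q : probability T R) D (g : T -> R) :
  measurable D -> q D = 1%E -> measurable_fun setT g -> (forall x, 0 <= g x) ->
  exists2 Z : R, 0 < Z <= 1 & (\int[q]_(x in D) (expR (- g x))%:E = Z%:E)%E.
Proof.
move=> mD qD mg g0.
have me : measurable_fun setT (EFin \o (fun x => expR (- g x))).
  by apply/measurable_EFinP; apply: measurableT_comp => //; exact: measurable_funN.
have le1 : (\int[q]_(x in D) (expR (- g x))%:E <= 1)%E.
  apply: (@le_trans _ _ (\int[q]_(x in D) cst 1 x)%E).
    apply: ge0_le_integral => //.
    - exact: (measurable_funTS me).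
    - by move=> x _; rewrite lee_fin -expR0 ler_expR oppr_le0.
  by rewrite integral_cst// mul1e; have := qD => /= ->.
have ge0 : (0 <= \int[q]_(x in D) (expR (- g x))%:E)%E.
  by apply: integral_ge0 => x _; rewrite lee_fin expR_ge0.
have fn : (\int[q]_(x in D) (expR (- g x))%:E)%E \is a fin_num.
  by rewrite ge0_fin_numE// (le_lt_trans le1)// ltry.
exists (fine (\int[q]_(x in D) (expR (- g x))%:E)%E); last by rewrite fineK.
rewrite -!lee_fin -lte_fin fineK// le1 andbT lt_neqAle ge0 andbT eq_sym.
(* A zero integral would make a positive function vanish almost everywhere on [D], which has mass
   1. *)
apply/eqP => i0.
have := i0; under eq_integral do rewrite -(gee0_abs (expR_ge0 _ : (0 <= (expR _)%:E)%E)).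
move/(ae_eq_integral_abs q mD (measurable_funTS me)) => [N [mN qN sN]].
have : (q D <= q N)%E.
  apply: le_measure; rewrite ?inE// => x Dx; apply: sN => /= /(_ Dx) [].
  by apply/eqP; rewrite gt_eqF ?expR_gt0.
by rewrite qD qN lee_fin ler10.
Qed.

End probability_integrals.

(** * The Donsker-Varadhan inequality *)

Section donsker_varadhan.
Context {R : realType} {d} {T : measurableType d}.

Lemma measurable_lne_EFin :
  measurable_fun [set: R] (fun r : R => lne r%:E).
Proof.
apply: measurable_fun_ifT => //; first exact: measurable_fun_ler.
by apply/measurable_EFinP; exact: measurable_ln.
Qed.

Lemma integrable_lt_pinfty (mu : {measure set T -> \bar R}) D (f : T -> R) :
  measurable D -> measurable_fun setT f -> (forall x, D x -> 0 <= f x) ->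
  (\int[mu]_(x in D) (f x)%:E < +oo)%E -> mu.-integrable D (EFin \o f).
Proof.
move=> mD mf f0 foo; apply/integrableP; split.
  by apply/measurable_EFinP; exact: measurable_funTS.
rewrite (eq_integral (fun x => (f x)%:E))// => x /set_mem Dx /=.
by rewrite ger0_norm ?f0.
Qed.

(* Here a stands for the logarithm of the density of p with respect to a
   reference measure q, and the two bounds on integrals of exponentials say
   q D <= 1 and \int[q] expR (- g) <= Z; the conclusion integrates
   1 - expR (- u) <= u for u = a + g + ln Z. *)
Lemma donsker_varadhan_ln (p : probability T R) D (a g : T -> R) (Z : R) :
  measurable D -> p D = 1%E ->
  measurable_fun setT a -> measurable_fun setT g -> (forall x, 0 <= g x) ->
  0 < Z ->
  (\int[p]_(x in D) (expR (- a x))%:E <= 1)%E ->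
  (\int[p]_(x in D) (expR (- (a x + g x)))%:E <= Z%:E)%E ->
  ((- ln Z)%:E <= \int[p]_(x in D) (g x)%:E + \int[p]_(x in D) (a x)%:E)%E.
Proof.
move=> mD pD ma mg g0 Z0 ia iag.
have me (b : T -> R) : measurable_fun setT b ->
    measurable_fun setT (fun x => expR (- b x)).
  by move=> mb; apply: measurableT_comp => //; exact: measurable_funN.
have ie : p.-integrable D (EFin \o (fun x => expR (- a x))).
  apply: integrable_lt_pinfty => //; first exact: me.
  by rewrite (le_lt_trans ia)// ltry.
have ieg : p.-integrable D (EFin \o (fun x => expR (- (a x + g x)))).
  apply: integrable_lt_pinfty => //; first by apply: me; exact: measurable_funD.
  by rewrite (le_lt_trans iag)// ltry.
have g_ge0 : (0 <= \int[p]_(x in D) (g x)%:E)%E.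
  by apply: integral_ge0 => x _; rewrite lee_fin.
have mDa : measurable_fun D (EFin \o a).
  by apply/measurable_EFinP; exact: measurable_funTS.
(* The negative part of [a] is at most [expR (- a)], so its integral is finite. Only the positive
   part of [a], or [g], can have infinite integral, and then the bound is trivial. *)
have negfin : (\int[p]_(x in D) (EFin \o a)^\- x < +oo)%E.
  apply: (@le_lt_trans _ _ (\int[p]_(x in D) (expR (- a x))%:E)%E); last first.
    by rewrite (le_lt_trans ia)// ltry.
  apply: ge0_le_integral => //.
  - exact: measurable_funeneg.
  - by apply/measurable_EFinP; apply: measurable_funTS; exact: me.
  - move=> x _; rewrite funenegE/= -EFin_max lee_fin ge_max expR_ge0 andbT.
    by rewrite (le_trans _ (expR_ge1Dx _))// lerDr.
have neg0 : (0 <= \int[p]_(x in D) (EFin \o a)^\- x)%E by exact: integral_ge0.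
have negf : (\int[p]_(x in D) (EFin \o a)^\- x)%E \is a fin_num.
  by rewrite ge0_fin_numE.
have pos0 : (0 <= \int[p]_(x in D) (EFin \o a)^\+ x)%E by exact: integral_ge0.
have [posoo|pos_fin] := eqVneq (\int[p]_(x in D) (EFin \o a)^\+ x)%E +oo%E.
  rewrite [X in (_ <= _ + X)%E]integralE posoo addye ?fin_numN//.
  rewrite addey ?leey//; first by rewrite gt_eqF// (lt_le_trans _ g_ge0).
  by move: negf; rewrite -fin_numN fin_numE => /andP[].
have inta : p.-integrable D (EFin \o a).
  apply/integrableP; split => //.
  rewrite (eq_integral ((EFin \o a)^\+ \+ (EFin \o a)^\-)%E); last first.
    by move=> x _; have /(congr1 (@^~ x)) := fune_abse (EFin \o a).
  rewrite ge0_integralD//; [|exact: measurable_funepos|exact: measurable_funeneg].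
  by rewrite lte_add_pinfty// ltey.
have [goo|g_fin] := eqVneq (\int[p]_(x in D) (g x)%:E)%E +oo%E.
  rewrite goo addye ?leey//.
  by have := integrable_fin_num mD inta; rewrite fin_numE => /andP[].
have intg : p.-integrable D (EFin \o g).
  by apply: integrable_lt_pinfty => //; rewrite ltey.
rewrite -(integralD mD intg inta).
have intc : p.-integrable D (EFin \o cst (1 - ln Z)).
  exact: finite_measure_integrable_cst.
(* [b] is an integrable minorant of [a + g]; the bound by [Z] on the second exponential integral
   makes its integral at least [- ln Z]. *)
pose b x := (1 - ln Z) - Z^-1 * expR (- (a x + g x)).
have intb : p.-integrable D (EFin \o b).
  have := integrableB mD intc (integrableZl mD Z^-1 ieg).
  exact.
apply: (@le_trans _ _ (\int[p]_(x in D) (b x)%:E)%E).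
  under eq_integral do rewrite EFinB EFinM.
  rewrite integralB//; last exact: integrableZl.
  rewrite integralZl// integral_cst//.
  have -> : ((1 - ln Z)%:E * p D = (1 - ln Z)%:E)%E by rewrite pD mule1.
  have fI := integrable_fin_num mD ieg; rewrite /= in fI.
  move: iag; rewrite -(fineK fI) -EFinM -EFinB !lee_fin => iag.
  have : Z^-1 * fine (\int[p]_(x in D) (expR (- (a x + g x)))%:E) <= 1.
    by rewrite mulrC ler_pdivrMr// mul1r.
  lra.
apply: le_integral => //; first exact: integrableD.
move=> x _; rewrite -EFinD lee_fin /b.
have -> : Z^-1 * expR (- (a x + g x)) = expR (- (a x + g x + ln Z)).
  by rewrite (opprD (a x + g x)) expRD (expRN (ln Z)) lnK ?posrE// mulrC.
have := expR_ge1Dx (- (a x + g x + ln Z)); lra.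
Qed.

End donsker_varadhan.

(** * Variational bounds for the relative entropy *)

Section entropy_bounds.
Context {R : realType} {d} {T : measurableType d}.

Lemma donsker_varadhan (p q : probability T R) (g : T -> R) (Z : R) :
  measurable_fun setT g -> (forall x, 0 <= g x) -> 0 < Z ->
  (\int[q]_x (expR (- g x))%:E = Z%:E)%E ->
  ((- ln Z)%:E <= \int[p]_x (g x)%:E + KL p q)%E.
Proof.
move=> mg g0 Z0 qZ; rewrite /KL; case: asboolP => [pq|_]; last first.
  rewrite addey ?leey// gt_eqF// (lt_le_trans (ltNyr 0))//.
  by apply: integral_ge0 => x _; rewrite lee_fin.
(* This version of the density is finite and nonnegative at every point. It agrees [q]-almost
   everywhere with the one in [KL], hence also [p]-almost everywhere because [p] is dominated by
   [q]. *)
pose f := Radon_Nikodym_SigmaFinite.f p q.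
pose r x := fine (f x).
have fr x : f x = (r x)%:E.
  by rewrite /r fineK//; exact: Radon_Nikodym_SigmaFinite.f_fin_num.
have mr : measurable_fun setT r.
  apply: measurableT_comp; first exact: fine_measurable.
  exact: (measurable_int q (Radon_Nikodym_SigmaFinite.f_integrable pq)).
have r0 x : 0 <= r x by rewrite -lee_fin -fr Radon_Nikodym_SigmaFinite.f_ge0.
have pE A : measurable A -> (p A = \int[q]_(x in A) (r x)%:E)%E.
  move=> mA; under eq_integral do rewrite -fr.
  exact: Radon_Nikodym_SigmaFinite.f_integral.
have mlr : measurable_fun setT (fun x => lne (r x)%:E).
  by apply: (measurableT_comp measurable_lne_EFin).
have -> : (\int[p]_x lne (Radon_Nikodym (charge_of_finite_measure p) q x) =
    \int[p]_x lne (r x)%:E)%E.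
  apply: ae_eq_integral => //.
    apply: (eq_measurable_fun (fun x => lne (fine
        (Radon_Nikodym (charge_of_finite_measure p) q x))%:E)).
      by move=> x _; rewrite fineK//; exact: Radon_Nikodym_fin_num.
    apply: (measurableT_comp measurable_lne_EFin).
    apply: (measurableT_comp (fine_measurable measurableT)) => //.
  have := null_dominates_ae_eq measurableT pq
    (ae_eq_Radon_Nikodym_SigmaFinite pq measurableT).
  by apply: filterS => x /= /(_ Logic.I) + _; rewrite -/f fr => <-.
(* On [D] the logarithm of the density is a real number, and [p] does not charge the complement,
   where the density is 0. *)
pose D := [set x | 0 < r x].
have mD : measurable D.
  have /measurable_EFinP mEr := mr.
  have := emeasurable_fun_o_infty measurableT mEr 0%E.
  by rewrite setTI.
have pD : p D = 1%E.
  have : (p (~` D) = 0)%E.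
    rewrite pE ?integral0_eq//; last exact: measurableC.
    by move=> x /= /negP; rewrite -leNgt => rx; congr EFin; apply/le_anti/andP.
  rewrite probability_setC// -(fineK (fin_num_measure p _ mD)) -EFinB.
  by case=> /eqP; rewrite subr_eq0 => /eqP <-.
rewrite -(integral_prob1 _ D)//; last exact/measurable_EFinP.
rewrite -[X in (_ + X)%E](integral_prob1 _ D)//.
rewrite [X in (_ + X)%E](eq_integral (fun x => (ln (r x))%:E)); last first.
  by move=> x /set_mem Dx; rewrite lne_EFin.
have mln : measurable_fun setT (fun x => ln (r x)).
  by apply: measurableT_comp => //; exact: measurable_ln.
(* Under [p] the factor [expR (- ln r)] cancels the density. With [b = 0] this gives the mass
   [q D <= 1], with [b = g] an integral at most [Z]. *)
have dens (b : T -> R) : measurable_fun setT b ->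
    (\int[p]_(x in D) (expR (- (ln (r x) + b x)))%:E =
     \int[q]_(x in D) (expR (- b x))%:E)%E.
  move=> mb; rewrite (integral_dens q _ r)//.
  - apply: eq_integral => x /set_mem Dx; rewrite -EFinM opprD expRD (expRN (ln (r x))) lnK//.
    by rewrite mulrAC mulVf ?mul1r// gt_eqF.
  - apply/measurable_EFinP; apply: measurableT_comp => //.
    by apply: measurable_funN; exact: measurable_funD.
apply: (donsker_varadhan_ln _ _ _ _ Z) => //.
  have := dens (cst 0) (measurable_cst _); rewrite /cst oppr0 expR0.
  under eq_integral do rewrite addr0; move=> ->.
  by rewrite integral_cst// mul1e; exact: probability_le1.
rewrite dens// -qZ; apply: ge0_subset_integral => //.
apply/measurable_EFinP; apply: measurableT_comp => //.
exact: measurable_funN.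
Qed.

(** The case [g = 0], [Z = 1] of the previous inequality. It keeps the sums with [KL] away from the
    indeterminate form of the extended reals. *)
Lemma KL_ge0 (p q : probability T R) : (0 <= KL p q)%E.
Proof.
have := @donsker_varadhan p q (cst 0) 1 (measurable_cst _) (fun=> lexx 0) ltr01.
under eq_integral do rewrite oppr0 expR0.
rewrite integral_cst// mul1e; have /= -> := probability_setT q.
move=> /(_ erefl); rewrite ln1 oppr0.
by rewrite integral0 add0e.
Qed.

(** This is the equality case of the variational formula with the nonnegative divergence of [nu]
    from [q] dropped. Directly: multiplying [1 + u <= expR u], for [u = ln Z + g], by the density
    [expR (- u)] gives [g * density <= 1 - (1 + ln Z) * density], whose right side has integral
    [- ln Z]. In particular [g] has finite integral under [nu]. *)
Lemma le_integral_gibbs (q nu : probability T R) D (g : T -> R) (Z : R) :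
  measurable D -> q D = 1%E -> measurable_fun setT g -> (forall x, 0 <= g x) ->
  0 < Z -> (\int[q]_(x in D) (expR (- g x))%:E = Z%:E)%E ->
  (forall A, measurable A ->
     nu A = \int[q]_(x in A) (Z^-1 * expR (- g x))%:E)%E ->
  (\int[nu]_(x in D) (g x)%:E <= (- ln Z)%:E)%E.
Proof.
move=> mD qD mg g0 Z0 qZ nuE.
have me : measurable_fun setT (fun x => expR (- g x)).
  by apply: measurableT_comp => //; exact: measurable_funN.
have ie : q.-integrable D (EFin \o (fun x => expR (- g x))).
  by apply: integrable_lt_pinfty => //; rewrite qZ ltry.
have intc : q.-integrable D (EFin \o cst 1).
  exact: finite_measure_integrable_cst.
have md : measurable_fun setT (fun x => Z^-1 * expR (- g x)).
  exact: measurable_funM.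
have d0 x : 0 <= Z^-1 * expR (- g x).
  by rewrite mulr_ge0 ?invr_ge0 ?expR_ge0// ltW.
have /measurable_EFinP mEg := mg.
rewrite (integral_dens q nu _ D (EFin \o g) md d0 nuE mD mEg)//.
have := integrableB mD intc (integrableZl mD (Z^-1 * (1 + ln Z)) ie) => ib.
apply: (@le_trans _ _ (\int[q]_(x in D)
    (1 - Z^-1 * (1 + ln Z) * expR (- g x))%:E)%E).
  apply: ge0_le_integral => //.
  - by move=> x _; rewrite mule_ge0 ?lee_fin.
  - apply: measurable_funTS; apply: emeasurable_funM => //.
    exact/measurable_EFinP.
  - exact: (measurable_int q ib).
  - move=> x _; rewrite -EFinM lee_fin.
    have := expR_ge1Dx (ln Z + g x); rewrite expRD lnK// => h.
    have := ler_wpM2r (d0 x) h.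
    rewrite mulrACA divff ?gt_eqF// expRN divff ?gt_eqF ?expR_gt0// mul1r.
    lra.
have -> : (\int[q]_(x in D) (1 - Z^-1 * (1 + ln Z) * expR (- g x))%:E =
    \int[q]_(x in D) 1%:E - (Z^-1 * (1 + ln Z))%:E *
      \int[q]_(x in D) (expR (- g x))%:E)%E.
  rewrite -integralZl// -integralB//; exact: integrableZl.
rewrite integral_cst// qZ mul1e; have /= -> := qD.
rewrite -EFinD lee_fin mulrAC mulVf ?gt_eqF// mul1r opprD addrA subrr.
by rewrite add0r.
Qed.

End entropy_bounds.

(** * Exponential tilting *)

Section exponential_tilt.
Context {R : realType} {d} {T : measurableType d}.
Variables (mu : probability T R) (D : set T) (mD : measurable D) (muD : mu D = 1%E).
Variables (h : T -> R) (L : R) (mh : measurable_fun setT h).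
Hypothesis oscD : forall x y, D x -> D y -> `|h x - h y| <= L.

Lemma prob1_nonempty : D !=set0.
Proof.
apply/set0P/eqP => D0; move: muD; rewrite D0 measure0 => /eqP.
by rewrite eq_sym onee_eq0.
Qed.

Lemma Rintegral_prob1_cst c : \int[mu]_(x in D) c = c.
Proof. by rewrite Rintegral_cst//; have /= -> := muD; rewrite mulr1. Qed.

Lemma integrable_osc : mu.-integrable D (EFin \o h).
Proof.
have [x0 Dx0] := prob1_nonempty.
apply: (@integrable_fin_prob _ _ _ _ _ _ (`|h x0| + L)) => // x Dx.
have := oscD _ _ Dx Dx0; have := lerB_dist (h x) (h x0); lra.
Qed.

Let m := \int[mu]_(x in D) h x.

Lemma dist_mean_osc x : D x -> `|h x - m| <= L.
Proof.
move=> Dx; have ic := finite_measure_integrable_cst mu (h x) mD.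
have -> : h x - m = \int[mu]_(y in D) (h x - h y).
  by rewrite RintegralB//; [rewrite Rintegral_prob1_cst|exact: integrable_osc].
apply: (le_trans (le_normr_Rintegral mD _)).
  exact: (integrableB mD ic integrable_osc).
rewrite -[leRHS]Rintegral_prob1_cst; apply: le_Rintegral => //.
- apply: (@integrable_fin_prob _ _ _ _ _ _ L) => //.
    by apply: measurableT_comp => //; exact: measurable_funB.
  by move=> y Dy /=; rewrite normr_id; exact: oscD.
- exact: finite_measure_integrable_cst.
- by move=> y Dy; exact: oscD.
Qed.

(* The constant 3 / 2 is where the factors 3 and 6 of the temperature come from. *)
Lemma expR_half_le (u : R) : `|u| <= 2^-1 -> u * (1 - expR (- u)) <= 3 / 2 * u ^+ 2.
Proof.
move=> u2; have [u0|u0] := leP 0 u.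
  have e1 := expR_ge1Dx (- u).
  have : u * (1 - expR (- u)) <= u * u by rewrite ler_wpM2l//; lra.
  have := sqr_ge0 u; rewrite expr2; lra.
rewrite ltr0_norm// in u2.
(* For s = - u / 3 <= 1 / 6, (expR s) ^+ 3 <= (1 - s) ^- 3 <= 1 + 9 / 2 * s;
   the cruder bound expR (3 * s) <= (1 - 3 * s)^-1 would miss the constant. *)
pose s := - u / 3; have s0 : 0 < s by rewrite /s; lra.
have s6 : s <= 6^-1 by rewrite /s; lra.
have us : u = - (3 * s) by rewrite /s; field.
clearbody s.
pose q := expR s.
have q1 : q * (1 - s) <= 1.
  rewrite -[leRHS](expRxMexpNx_1 s) ler_wpM2l ?expR_ge0//.
  exact: expR_ge1Dx.
have q3 : expR (- u) = q ^+ 3 by rewrite us opprK -expRM_natl.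
have q4 : q ^+ 3 * (1 - s) ^+ 3 <= 1.
  rewrite -exprMn exprn_ile1// mulr_ge0 ?expR_ge0//; lra.
have q5 : q ^+ 3 <= 1 + 9 / 2 * s.
  rewrite -(@ler_pM2r _ ((1 - s) ^+ 3)) ?exprn_gt0//; last lra.
  apply: (le_trans q4).
  have -> : (1 + 9 / 2 * s) * (1 - s) ^+ 3 =
    1 + s * (3 / 2 - 21 / 2 * s + s ^+ 2 * (25 / 2 - 9 / 2 * s)) by field.
  rewrite lerDl mulr_ge0//; first exact: ltW.
  (* It remains to see that [3 / 2 - 21 / 2 * s + 11 * s ^+ 2 >= 0] for [s <= 1 / 6]. Replacing the
     square by its tangent at [1 / 6] makes this linear in [s], with value [1 / 18] at the
     endpoint. *)
  have s2 : (s - 6^-1) ^+ 2 >= 0 by exact: sqr_ge0.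
  have : s ^+ 2 * 11 <= s ^+ 2 * (25 / 2 - 9 / 2 * s).
    by rewrite ler_wpM2l ?sqr_ge0//; lra.
  have -> : s ^+ 2 = (s - 6^-1) ^+ 2 + s / 3 - 36^-1 by field.
  lra.
rewrite q3 us.
have : s * q ^+ 3 <= s * (1 + 9 / 2 * s) by rewrite ler_wpM2l// ltW.
lra.
Qed.

Lemma integrable_tilt (a : R) :
  mu.-integrable D (EFin \o (fun x => expR (- (a * h x)))) /\
  mu.-integrable D (EFin \o (fun x => h x * expR (- (a * h x)))).
Proof.
have [x0 Dx0] := prob1_nonempty.
have mw : measurable_fun setT (fun x => expR (- (a * h x))).
  apply: measurableT_comp => //; apply: measurable_funN.
  exact: measurable_funM.
have hM x : D x -> `|h x| <= `|h x0| + L.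
  by move=> Dx; have := oscD _ _ Dx Dx0; have := lerB_dist (h x) (h x0); lra.
pose W := expR (`|a| * (`|h x0| + L)).
have wW x : D x -> `|expR (- (a * h x))| <= W.
  move=> Dx; rewrite ger0_norm ?expR_ge0// ler_expR.
  by rewrite (le_trans (ler_norm _))// normrN normrM ler_wpM2l// hM.
split; first exact: integrable_fin_prob wW.
apply: (@integrable_fin_prob _ _ _ _ _ _ ((`|h x0| + L) * W)) => //.
  exact: measurable_funM.
by move=> x Dx; rewrite normrM ler_pM// ?hM ?wW.
Qed.

(** Put [k = h - m] and [e = expR (- (a * m))]. The denominator is at least [e], by
    [1 - a * k <= expR (- (a * k))] and since [k] has mean 0. The numerator of the difference is [e]
    times the integral of [a * k * (1 - expR (- (a * k)))], again because [k] has mean 0, and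
    [expR_half_le] bounds this integrand by [3 / 2 * (a * k) ^+ 2]. *)
Lemma tilted_mean_le (a : R) : `|a| * L <= 2^-1 ->
  a * (m - (\int[mu]_(x in D) (h x * expR (- (a * h x)))) /
           (\int[mu]_(x in D) expR (- (a * h x)))) <=
  3 / 2 * a ^+ 2 * \int[mu]_(x in D) (h x - m) ^+ 2.
Proof.
move=> aL.
pose w x := expR (- (a * h x)); pose e := expR (- (a * m)).
have [iw ihw] := integrable_tilt a.
have ih := integrable_osc.
have mk : measurable_fun setT (fun x => h x - m) by exact: measurable_funB.
have ic (c : R) := finite_measure_integrable_cst mu c mD.
have ik : mu.-integrable D (EFin \o (fun x => h x - m)).
  exact: (integrableB mD ih (ic m)).
have ik2 : mu.-integrable D (EFin \o (fun x => (h x - m) ^+ 2)).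
  apply: (@integrable_fin_prob _ _ _ _ _ _ (L ^+ 2)) => //.
    exact: measurable_funX.
  by move=> x Dx; rewrite normrX lerXn2r ?nnegrE// ?dist_mean_osc//
    (le_trans _ (dist_mean_osc _ Dx)).
have k0 : \int[mu]_(x in D) (h x - m) = 0.
  by rewrite RintegralB//; [rewrite Rintegral_prob1_cst subrr|exact: ic].
set den := \int[mu]_(x in D) w x; set num := \int[mu]_(x in D) (h x * w x).
set v := \int[mu]_(x in D) (h x - m) ^+ 2.
have wk x : w x = e * expR (- (a * (h x - m))).
  by rewrite /w /e -expRD; congr expR; ring.
have e0 : 0 < e by exact: expR_gt0.
have v0 : 0 <= v by apply: Rintegral_ge0 => x _; exact: sqr_ge0.
have eden : e <= den.
  have -> : e = \int[mu]_(x in D) (e - e * a * (h x - m)).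
    rewrite RintegralB//; first by rewrite RintegralZl// k0 mulr0 subr0 Rintegral_prob1_cst.
      exact: ic.
    exact: (integrableZl mD (e * a) ik).
  apply: le_Rintegral => //.
    exact: (integrableB mD (ic e) (integrableZl mD (e * a) ik)).
  move=> x Dx; rewrite wk -{1}[e]mulr1 -mulrA -mulrBr ler_wpM2l ?(ltW e0)//.
  exact: expR_ge1Dx.
have den0 : 0 < den by exact: lt_le_trans eden.
have numle : a * (m * den - num) <= e * (3 / 2 * a ^+ 2) * v.
  have -> : a * (m * den - num) = \int[mu]_(x in D) (a * m * w x - a * (h x * w x)).
    rewrite RintegralB//; first by rewrite !RintegralZl// -/den -/num; ring.
      exact: (integrableZl mD _ iw).
    exact: (integrableZl mD _ ihw).
  have -> : e * (3 / 2 * a ^+ 2) * v =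
      \int[mu]_(x in D) (e * (3 / 2 * a ^+ 2) * (h x - m) ^+ 2 - e * a * (h x - m)).
    rewrite RintegralB//; first by rewrite !RintegralZl// k0 mulr0 subr0.
      exact: (integrableZl mD _ ik2).
    exact: (integrableZl mD _ ik).
  apply: le_Rintegral => //.
  - exact: (integrableB mD (integrableZl mD _ iw) (integrableZl mD _ ihw)).
  - exact: (integrableB mD (integrableZl mD _ ik2) (integrableZl mD _ ik)).
  move=> x Dx; rewrite wk; set E := expR _.
  have -> : a * m * (e * E) - a * (h x * (e * E)) =
      e * (a * (h x - m) * (1 - E) - a * (h x - m)) by ring.
  have -> : e * (3 / 2 * a ^+ 2) * (h x - m) ^+ 2 - e * a * (h x - m) =
           e * (3 / 2 * (a * (h x - m)) ^+ 2 - a * (h x - m)) by ring.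
  rewrite ler_wpM2l ?(ltW e0)// lerB//; apply: expR_half_le.
  by rewrite normrM (le_trans _ aL)// ler_wpM2l// dist_mean_osc.
have -> : a * (m - num / den) = (a * (m * den - num)) / den.
  by field; rewrite gt_eqF.
rewrite ler_pdivrMr//; apply: (le_trans numle).
rewrite -mulrA mulrC ler_wpM2l// mulr_ge0// mulr_ge0 ?sqr_ge0//; lra.
Qed.

End exponential_tilt.

(** * The empirical loss and the bias-variance identity *)

Section matrix_loss.
Context {R : realType} {K n : nat}.
Implicit Types (F G Y : 'M[R]_(K, n)).

Definition ip F G : R := \sum_j \sum_i F j i * G j i.

Lemma frob_norm_sqr m l (A : 'M[R]_(m, l)) :
  frob_norm A ^+ 2 = \sum_j \sum_i A j i ^+ 2.
Proof.
rewrite sqr_sqrtr//; do 2 (apply: sumr_ge0 => ? _); exact: sqr_ge0.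
Qed.

Lemma ellE F G : ell F G = n%:R^-1 * \sum_j \sum_i (F j i - G j i) ^+ 2.
Proof.
rewrite /ell frob_norm_sqr; congr (_ * _).
by apply: eq_bigr => j _; apply: eq_bigr => i _; rewrite !mxE.
Qed.

Lemma ell_ge0 F G : 0 <= ell F G.
Proof. by rewrite mulr_ge0 ?invr_ge0 ?sqr_ge0. Qed.

Lemma ellC F G : ell F G = ell G F.
Proof.
rewrite !ellE; congr (_ * _); apply: eq_bigr => j _; apply: eq_bigr => i _.
by rewrite -sqrrN opprB.
Qed.

Lemma ell_split F G Y :
  ell F Y = ell F G + ell G Y + 2 / n%:R * ip (F - G) (G - Y).
Proof.
rewrite !ellE -mulrDr -mulrA (mulrCA 2) -mulrDr; congr (_ * _).
rewrite -big_split/= mulr_sumr -big_split; apply: eq_bigr => j _ /=.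
rewrite -big_split/= mulr_sumr -big_split; apply: eq_bigr => i _ /=.
by rewrite !mxE; ring.
Qed.

Lemma sqr_entry_le_ell F Y j i : (0 < n)%N -> (F j i - Y j i) ^+ 2 <= n%:R * ell F Y.
Proof.
move=> n0; rewrite ellE mulVKf ?pnatr_eq0 -?lt0n//.
rewrite (bigD1 j)//= (bigD1 i)//= -addrA lerDl.
by apply: addr_ge0; repeat (apply: sumr_ge0 => ? _); exact: sqr_ge0.
Qed.

Lemma ipDr F G Y : ip F (G + Y) = ip F G + ip F Y.
Proof.
rewrite /ip -big_split; apply: eq_bigr => j _; rewrite -big_split.
by apply: eq_bigr => i _ /=; rewrite !mxE mulrDr.
Qed.

Lemma ipC F G : ip F G = ip G F.
Proof. by apply: eq_bigr => j _; apply: eq_bigr => i _; rewrite mulrC. Qed.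

Lemma ipNr F G : ip F (- G) = - ip F G.
Proof.
rewrite /ip -sumrN; apply: eq_bigr => j _; rewrite -sumrN.
by apply: eq_bigr => i _; rewrite mxE mulrN.
Qed.

Lemma measurable_ell d (T : measurableType d) (f g : T -> 'M[R]_(K, n)) :
  measurable_fun setT f -> measurable_fun setT g ->
  measurable_fun setT (fun x => ell (f x) (g x)).
Proof.
move=> mf mg; under eq_fun do rewrite ellE.
apply: measurable_funM => //.
do 2 (apply: measurable_sum => ?); apply: measurable_funX.
by apply: measurable_funB; exact: (measurableT_comp (measurable_mx_entry _ _)).
Qed.

Lemma measurable_mx d (T : measurableType d) (f : T -> 'M[R]_(K, n)) :
  (forall j i, measurable_fun setT (fun x => f x j i)) -> measurable_fun setT f.
Proof.
move=> mf; apply: (@measurability _ _ _ _ _ _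
  [set A | exists j i (B : set R), measurable B /\
    A = (fun M : 'M[R]_(K, n) => M j i) @^-1` B]) => // _ [_ [j [i [B [mB ->]]]] <-].
exact: mf.
Qed.

End matrix_loss.

(** * First and second moments of a law on matrices *)

Section moments.
Context {R : realType} {K n : nat} (n0 : (0 < n)%N).
Variables (mu : probability 'M[R]_(K, n) R) (D : set 'M[R]_(K, n)).
Hypotheses (mD : measurable D) (muD : mu D = 1%E).

Definition mean : 'M[R]_(K, n) := \matrix_(j, i) \int[mu]_(F in D) F j i.

Lemma integrable_ell (Y : 'M[R]_(K, n)) :
  (\int[mu]_(F in D) (ell F Y)%:E < +oo)%E -> mu.-integrable D (fun F => (ell F Y)%:E).
Proof.
move=> h; apply: integrable_lt_pinfty => //.
  exact: measurable_ell.
by move=> F _; exact: ell_ge0.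
Qed.

Section finite_second_moment.
Variable Y : 'M[R]_(K, n).
Hypothesis iY : mu.-integrable D (fun F => (ell F Y)%:E).

Lemma integrable_entry j i : mu.-integrable D (EFin \o (fun F : 'M[R]_(K, n) => F j i)).
Proof.
pose b (F : 'M[R]_(K, n)) := (1 + `|Y j i|) + n%:R * ell F Y.
have ib : mu.-integrable D (EFin \o b).
  have ic := finite_measure_integrable_cst mu (1 + `|Y j i|) mD.
  exact: (integrableD mD ic (integrableZl mD n%:R iY)).
apply: le_integrable ib => //.
  by apply/measurable_EFinP; apply: measurable_funTS; exact: measurable_mx_entry.
move=> F _ /=; rewrite lee_fin.
have bF : 0 <= b F by apply: addr_ge0; [exact: addr_ge0|rewrite mulr_ge0 ?ell_ge0].
rewrite [leRHS]ger0_norm// /b.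
have h := sqr_entry_le_ell F Y j i n0.
have h1 : `|F j i - Y j i| <= 1 + (F j i - Y j i) ^+ 2.
  rewrite -[X in _ <= 1 + X]real_normK ?num_real//.
  by have := sqr_ge0 (`|F j i - Y j i| - 2^-1); lra.
have := lerB_dist (F j i) (Y j i); lra.
Qed.

Lemma Rintegral_ip (C : 'M[R]_(K, n)) :
  mu.-integrable D (EFin \o (fun F => ip (F - mean) C)) /\
  \int[mu]_(F in D) ip (F - mean) C = 0.
Proof.
pose f (j : 'I_K) (i : 'I_n) (F : 'M[R]_(K, n)) := (F j i - mean j i) * C j i.
have if_ j i : mu.-integrable D (EFin \o f j i).
  have ic := finite_measure_integrable_cst mu (mean j i) mD.
  have := integrableZr mD (C j i) (integrableB mD (integrable_entry j i) ic).
  exact.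
have f0 j i : (\int[mu]_(F in D) (f j i F)%:E = 0)%E.
  have ic := finite_measure_integrable_cst mu (mean j i) mD.
  have : \int[mu]_(F in D) f j i F = 0.
    rewrite RintegralZr//; last exact: (integrableB mD (integrable_entry j i) ic).
    rewrite RintegralB//; last exact: integrable_entry.
    by rewrite Rintegral_prob1_cst// mxE subrr mul0r.
  rewrite /Rintegral => h; rewrite -[LHS]fineK ?h//.
  exact: (integrable_fin_num mD (if_ j i)).
have ipE F : (ip (F - mean) C)%:E = (\sum_j \sum_i (f j i F)%:E)%E.
  under [RHS]eq_bigr do rewrite sumEFin.
  rewrite sumEFin; congr EFin; apply: eq_bigr => j _.
  by apply: eq_bigr => i _; rewrite /f !mxE.
have is1 j : mu.-integrable D (fun F => \sum_i (f j i F)%:E)%E.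
  exact: (integrable_sum mD (index_enum _) (fun i _ => if_ j i)).
have is2 : mu.-integrable D (fun F => \sum_j \sum_i (f j i F)%:E)%E.
  exact: (integrable_sum mD (index_enum _) (fun j _ => is1 j)).
split; first by apply: eq_integrable is2 => // F _; rewrite /= ipE.
rewrite /Rintegral; under eq_integral do rewrite ipE.
rewrite integral_sum// big1// => j _.
rewrite integral_sum; [|by []|exact: if_].
by rewrite big1.
Qed.

Lemma Rintegral_ip_mean (C : 'M[R]_(K, n)) :
  mu.-integrable D (EFin \o (fun F => ip F C)) /\
  \int[mu]_(F in D) ip F C = ip mean C.
Proof.
have [ii i0] := Rintegral_ip C.
have ic := finite_measure_integrable_cst mu (ip mean C) mD.
have ipE F : ip F C = ip (F - mean) C + ip mean C.
  by rewrite 3!(ipC _ C) -ipDr subrK.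
split; first by apply: eq_integrable (integrableD mD ii ic) => // F _; rewrite /= (ipE F).
under eq_Rintegral => F _ do rewrite (ipE F).
by rewrite RintegralD// i0 add0r Rintegral_prob1_cst.
Qed.

(** A finite expected loss to the single matrix [Y] is enough for every [Z]: expanding around
    [mean], the losses differ by constants and by an inner product with [F - mean], which is
    integrable with integral 0. *)
Lemma bias_variance (Z : 'M[R]_(K, n)) :
  mu.-integrable D (fun F => (ell F Z)%:E) /\
  \int[mu]_(F in D) ell F Z = ell mean Z + \int[mu]_(F in D) ell mean F.
Proof.
have i1 : mu.-integrable D (fun F => (ell mean F)%:E).
  have [ii _] := Rintegral_ip (mean - Y).
  have ic := finite_measure_integrable_cst mu (ell mean Y) mD.
  have ib := integrableB mD (integrableB mD iY ic) (integrableZl mD (2 / n%:R) ii).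
  apply: eq_integrable ib => //= F _.
  by rewrite (ell_split F mean Y) -!EFinB ellC; congr EFin; ring.
have [ii i0] := Rintegral_ip (mean - Z).
have ic := finite_measure_integrable_cst mu (ell mean Z) mD.
have zE F : ell F Z = (ell mean Z + ell mean F) + 2 / n%:R * ip (F - mean) (mean - Z).
  by rewrite (ell_split F mean Z) (ellC F mean); ring.
have iz := integrableZl mD (2 / n%:R) ii.
split.
  apply: eq_integrable (integrableD mD (integrableD mD ic i1) iz) => //= F _.
  by rewrite (zE F).
under eq_Rintegral => F _ do rewrite (zE F).
rewrite RintegralD//; last exact: (integrableD mD ic i1).
rewrite RintegralD// [X in _ + X = _]RintegralZl// i0 mulr0 addr0.
by rewrite Rintegral_prob1_cst.
Qed.

End finite_second_moment.
End moments.

(** * The tempered posterior *)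

Section gibbs_theory.
Context {R : realType} {K n : nat} (n0 : (0 < n)%N).
Variables (pi0 : probability 'M[R]_(K, n) R) (tau : R) (tau0 : 0 < tau).
Variables (D : set 'M[R]_(K, n)) (mD : measurable D) (piD : pi0 D = 1%E).
Local Notation gibbs := (gibbs pi0 tau).

Let c : R := (2 * tau)^-1.

Let c0 : 0 < c. Proof. by rewrite /c invr_gt0 mulr_gt0. Qed.

Let g (Y F : 'M[R]_(K, n)) : R := c * ell F Y.

Let g0 Y F : 0 <= g Y F.
Proof. by rewrite mulr_ge0 ?ell_ge0// ltW. Qed.

Let mg Y : measurable_fun setT (g Y).
Proof.
by apply: measurable_funM => //; apply: measurable_ell => //; exact: measurable_cst.
Qed.

(** The [Z(Y)] of the overview. Since [pi0 D = 1], integrating over all matrices gives the same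
    number ([gibbs_massT]). *)
Definition gibbs_mass (Y : 'M[R]_(K, n)) : R :=
  fine (\int[pi0]_(F in D) (gibbs_density tau Y F)%:E)%E.

Lemma gibbs_massP Y : 0 < gibbs_mass Y <= 1 /\
  (\int[pi0]_(F in D) (gibbs_density tau Y F)%:E = (gibbs_mass Y)%:E)%E.
Proof.
have [Z Z01 ZE] := integral_expRN pi0 D (g Y) mD piD (mg Y) (g0 Y).
by rewrite /gibbs_mass ZE.
Qed.

Lemma gibbs_mass_gt0 Y : 0 < gibbs_mass Y.
Proof. by have [/andP[]] := gibbs_massP Y. Qed.

Lemma gibbs_massT Y :
  (\int[pi0]_F (gibbs_density tau Y F)%:E = (gibbs_mass Y)%:E)%E.
Proof.
rewrite -(integral_prob1 pi0 D) ?(gibbs_massP Y).2//.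
by apply/measurable_EFinP; exact: measurable_gibbs_density.
Qed.

Lemma gibbsE Y A : measurable A ->
  gibbs Y A = (\int[pi0]_(F in A) ((gibbs_mass Y)^-1 * gibbs_density tau Y F)%:E)%E.
Proof.
move=> mA; have Z0 := gibbs_mass_gt0 Y.
rewrite /Defs.gibbs /mnormalize/= /mnormalize/=.
have -> : gibbs_weight pi0 tau Y setT = (gibbs_mass Y)%:E := gibbs_massT Y.
(* The mass is a positive real, which excludes the fallback branch of [mnormalize]. *)
rewrite /= eqe gt_eqF//= muleC.
under [RHS]eq_integral do rewrite EFinM.
rewrite ge0_integralZl//.
- apply/measurable_EFinP; apply: measurable_funTS.
  exact: measurable_gibbs_density.
- by move=> F _; rewrite lee_fin expR_ge0.
- by rewrite lee_fin invr_ge0 ltW.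
Qed.

Lemma ge0_integral_gibbs Y E f : measurable E -> measurable_fun setT f ->
  (forall F, 0 <= f F)%E ->
  (\int[gibbs Y]_(F in E) f F =
   (gibbs_mass Y)^-1%:E * \int[pi0]_(F in E) (f F * (gibbs_density tau Y F)%:E))%E.
Proof.
move=> mE mf f0; have Z0 := gibbs_mass_gt0 Y.
have md := measurable_gibbs_density tau Y.
rewrite (integral_dens pi0 (gibbs Y)
  (fun F => (gibbs_mass Y)^-1 * gibbs_density tau Y F))//.
- under eq_integral do rewrite EFinM muleCA.
  rewrite ge0_integralZl//.
  + apply: measurable_funTS; apply: emeasurable_funM => //.
    exact/measurable_EFinP.
  + by move=> F _; rewrite mule_ge0// lee_fin expR_ge0.
  + by rewrite lee_fin invr_ge0 ltW.
- exact: measurable_funM.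
- by move=> F; rewrite mulr_ge0 ?expR_ge0// invr_ge0 ltW.
- exact: gibbsE.
Qed.

Lemma gibbs1 Y : gibbs Y D = 1%E.
Proof.
rewrite gibbsE//; have Z0 := gibbs_mass_gt0 Y.
under eq_integral do rewrite EFinM.
rewrite ge0_integralZl//.
- by rewrite (gibbs_massP Y).2 -EFinM mulVf// gt_eqF.
- apply/measurable_EFinP; apply: measurable_funTS.
  exact: measurable_gibbs_density.
- by move=> F _; rewrite lee_fin expR_ge0.
- by rewrite lee_fin invr_ge0 ltW.
Qed.

(** [le_integral_gibbs] at [g = ell / (2 tau)]. Its finite right side is what gives the posterior
    second moments, whatever the size of [D]. *)
Lemma integral_ell_gibbs Y :
  (\int[gibbs Y]_(F in D) (ell F Y)%:E <= (- (2 * tau * ln (gibbs_mass Y)))%:E)%E.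
Proof.
have h := le_integral_gibbs pi0 (gibbs Y) D (g Y) (gibbs_mass Y) mD piD (mg Y)
  (g0 Y) (gibbs_mass_gt0 Y) (gibbs_massP Y).2 (gibbsE Y).
have t2 : 0 < 2 * tau by rewrite mulr_gt0.
have -> : (\int[gibbs Y]_(F in D) (ell F Y)%:E =
    (2 * tau)%:E * \int[gibbs Y]_(F in D) (g Y F)%:E)%E.
  rewrite -ge0_integralZl//; last by rewrite lee_fin ltW.
    apply: eq_integral => F _; rewrite -EFinM /g /c; congr EFin; field.
    by rewrite gt_eqF.
    by apply/measurable_EFinP; exact: measurable_funTS (mg Y).
  by move=> F _; rewrite lee_fin.
rewrite -mulrN (EFinM (2 * tau)) lee_wpmul2l// lee_fin ltW//.
Qed.

Lemma gibbs_variational (p : probability 'M[R]_(K, n) R) Y : p D = 1%E ->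
  ((- (2 * tau * ln (gibbs_mass Y)))%:E <=
   \int[p]_(F in D) (ell F Y)%:E + (2 * tau)%:E * KL p pi0)%E.
Proof.
move=> pD.
have h := donsker_varadhan p pi0 (g Y) (gibbs_mass Y) (mg Y) (g0 Y)
  (gibbs_mass_gt0 Y) (gibbs_massT Y).
have t2 : 0 < 2 * tau by rewrite mulr_gt0.
have -> : (\int[p]_(F in D) (ell F Y)%:E = (2 * tau)%:E * \int[p]_F (g Y F)%:E)%E.
  rewrite -(integral_prob1 p D)//; last exact/measurable_EFinP.
  rewrite -ge0_integralZl//; last by rewrite lee_fin ltW.
    apply: eq_integral => F _; rewrite -EFinM /g /c; congr EFin; field.
    by rewrite gt_eqF.
    by apply/measurable_EFinP; exact: measurable_funTS (mg Y).
  by move=> F _; rewrite lee_fin.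
rewrite -mulrN (EFinM (2 * tau)) -ge0_muleDr; last 2 first.
- by apply: integral_ge0 => F _; rewrite lee_fin.
- exact: KL_ge0.
by rewrite lee_wpmul2l// lee_fin ltW.
Qed.

Lemma integrable_ell_gibbs Y : (gibbs Y).-integrable D (fun F => (ell F Y)%:E).
Proof.
by apply: integrable_ell => //; rewrite (le_lt_trans (integral_ell_gibbs Y))// ltry.
Qed.

(** The [V(Y)] of the overview as a real number; [EFin_gibbs_spread] links it to the extended
    integral of the theorem. *)
Definition gibbs_spread Y : R := \int[gibbs Y]_(F in D) ell (EWA pi0 tau Y D) F.

Lemma gibbs_bias_variance Y (Z : 'M[R]_(K, n)) :
  (gibbs Y).-integrable D (fun F => (ell F Z)%:E) /\
  \int[gibbs Y]_(F in D) ell F Z = ell (EWA pi0 tau Y D) Z + gibbs_spread Y.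
Proof. exact: (bias_variance n0 (gibbs Y) D mD (gibbs1 Y) Y (integrable_ell_gibbs Y)). Qed.

Lemma gibbs_spread_ge0 Y : 0 <= gibbs_spread Y.
Proof. by apply: Rintegral_ge0 => F _; exact: ell_ge0. Qed.

(** By the bias-variance identity at [Y] itself, the left side is exactly the posterior mean of
    [ell F Y]. *)
Lemma EWA_spread_le Y :
  ell (EWA pi0 tau Y D) Y + gibbs_spread Y <= - (2 * tau * ln (gibbs_mass Y)).
Proof.
have [ii <-] := gibbs_bias_variance Y Y.
by rewrite -lee_fin fineK ?integral_ell_gibbs// integrable_fin_num.
Qed.

Lemma EFin_gibbs_spread Y :
  (\int[gibbs Y]_(F in D) (ell (EWA pi0 tau Y D) F)%:E = (gibbs_spread Y)%:E)%E.
Proof.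
rewrite fineK// integrable_fin_num//.
have [ii _] := gibbs_bias_variance Y (EWA pi0 tau Y D).
by apply: eq_integrable ii => // F _; rewrite ellC.
Qed.

End gibbs_theory.

(** * Measurable dependence of the posterior on the data *)

Section gibbs_measurability.
Context {R : realType} {K n : nat} (n0 : (0 < n)%N).
Variables (pi0 : probability 'M[R]_(K, n) R) (tau : R) (tau0 : 0 < tau).
Variables (D : set 'M[R]_(K, n)) (mD : measurable D) (piD : pi0 D = 1%E).
Local Notation gibbs := (gibbs pi0 tau).
Local Notation mass := (gibbs_mass pi0 tau D).
Context {d} {T : measurableType d} (Y : T -> 'M[R]_(K, n)) (mY : measurable_fun setT Y).

Lemma measurable_gibbs_density2 :
  measurable_fun setT (fun z : T * 'M[R]_(K, n) => gibbs_density tau (Y z.1) z.2).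
Proof.
apply: measurableT_comp => //; apply: measurable_funN.
apply: measurable_funM => //; apply: measurable_ell => //.
exact: measurableT_comp.
Qed.

Lemma measurable_gibbs_massV : measurable_fun setT (fun w => (mass (Y w))^-1).
Proof.
(* Inversion on R is obtained as expR \o -%R \o ln, measurable as a composite. *)
have -> : (fun w => (mass (Y w))^-1) = (fun w => expR (- ln (mass (Y w)))).
  by apply/funext => w; rewrite expRN lnK// posrE gibbs_mass_gt0.
apply: measurableT_comp => //; apply: measurable_funN.
apply: measurableT_comp; first exact: measurable_ln.
have -> : (fun w => mass (Y w)) =
    fine \o (fun w => \int[pi0]_F (gibbs_density tau (Y w) F)%:E)%E.
  by apply/funext => w /=; rewrite (gibbs_massT pi0 tau tau0 D).
apply: measurableT_comp; first exact: fine_measurable.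
apply: (measurable_fun_fubini_tonelli_F
  (fun z : T * 'M[R]_(K, n) => (gibbs_density tau (Y z.1) z.2)%:E)).
  by apply/measurable_EFinP; exact: measurable_gibbs_density2.
by move=> z; rewrite lee_fin expR_ge0.
Qed.

(** Here the measure varies with [w]. Moving the dependence into a density with respect to the fixed
    [pi0] gives an ordinary parameter integral, to which Tonelli's theorem applies. *)
Lemma measurable_ge0_integral_gibbs (f : T * 'M[R]_(K, n) -> \bar R) :
  measurable_fun setT f -> (forall z, 0 <= f z)%E ->
  measurable_fun setT (fun w => \int[gibbs (Y w)]_(F in D) f (w, F))%E.
Proof.
move=> mf f0.
have mfw w : measurable_fun setT (fun F => f (w, F)).
  by apply: measurableT_comp => //; exact: measurable_pair1.
have -> : (fun w => \int[gibbs (Y w)]_(F in D) f (w, F))%E =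
    (fun w => (mass (Y w))^-1%:E *
      \int[pi0]_F (f (w, F) * (gibbs_density tau (Y w) F)%:E))%E.
  apply/funext => w; rewrite (ge0_integral_gibbs pi0 tau tau0 D)//; congr (_ * _)%E.
  apply: integral_prob1 => //; apply: emeasurable_funM => //.
  by apply/measurable_EFinP; exact: measurable_gibbs_density.
apply: emeasurable_funM.
  by apply/measurable_EFinP; exact: measurable_gibbs_massV.
apply: (measurable_fun_fubini_tonelli_F
  (fun z : T * 'M[R]_(K, n) => f z * (gibbs_density tau (Y z.1) z.2)%:E))%E.
  apply: emeasurable_funM => //.
  by apply/measurable_EFinP; exact: measurable_gibbs_density2.
by move=> z; rewrite mule_ge0// lee_fin expR_ge0.
Qed.

Lemma measurable_Rintegral_gibbs (f : T * 'M[R]_(K, n) -> R) :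
  measurable_fun setT f ->
  measurable_fun setT (fun w => \int[gibbs (Y w)]_(F in D) f (w, F)).
Proof.
move=> mf; have /measurable_EFinP mEf := mf.
apply: (measurableT_comp (fine_measurable measurableT)).
under eq_fun do rewrite integralE.
apply: emeasurable_funB.
- have := @measurable_ge0_integral_gibbs ((EFin \o f)^\+)%E
    (measurable_funepos mEf) (fun z => funepos_ge0 _ z).
  apply: eq_measurable_fun => w _; apply: eq_integral => F _.
  by rewrite !funeposE.
- have := @measurable_ge0_integral_gibbs ((EFin \o f)^\-)%E
    (measurable_funeneg mEf) (fun z => funeneg_ge0 _ z).
  apply: eq_measurable_fun => w _; apply: eq_integral => F _.
  by rewrite !funenegE.
Qed.

Lemma measurable_EWA : measurable_fun setT (fun w => EWA pi0 tau (Y w) D).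
Proof.
apply: measurable_mx => j i; under eq_fun do rewrite mxE.
apply: (measurable_Rintegral_gibbs (fun z => z.2 j i)).
by apply: (measurableT_comp (measurable_mx_entry _ _)).
Qed.

Lemma measurable_gibbs_spread :
  measurable_fun setT (fun w => gibbs_spread pi0 tau D (Y w)).
Proof.
apply: (measurable_Rintegral_gibbs (fun z => ell (EWA pi0 tau (Y z.1) D) z.2)).
apply: measurable_ell => //.
exact: (measurableT_comp measurable_EWA).
Qed.

End gibbs_measurability.

(** * Bounds uniform over bounded data *)

Section gibbs_bounds.
Context {R : realType} {K n : nat} (n0 : (0 < n)%N).
Variables (pi0 : probability 'M[R]_(K, n) R) (tau : R) (tau0 : 0 < tau).
Variables (D : set 'M[R]_(K, n)) (mD : measurable D) (piD : pi0 D = 1%E).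

(** A lower bound on the mass, uniform over the data bounded by [M], bounds [- 2 tau ln Z(Y)], which
    by [EWA_spread_le] dominates both [V(Y)] and the loss of the estimator to the data. *)
Lemma EWA_bounded (M : R) : exists C : R, forall Y : 'M[R]_(K, n),
  (forall j i, `|Y j i| <= M) ->
  (forall j i, `|EWA pi0 tau Y D j i| <= C) /\ gibbs_spread pi0 tau D Y <= C.
Proof.
pose c : R := (2 * tau)^-1.
have c0 : 0 < c by rewrite /c invr_gt0 mulr_gt0.
have mell : measurable_fun setT (fun F : 'M[R]_(K, n) => 2 * c * ell F 0).
  by apply: measurable_funM => //; apply: measurable_ell => //; exact: measurable_cst.
have ell0 (F : 'M[R]_(K, n)) : 0 <= 2 * c * ell F 0.
  by rewrite mulr_ge0 ?ell_ge0// mulr_ge0// ltW.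
(* The doubled rate [2 * c] comes from [(x - y)^2 <= 2 x^2 + 2 y^2]: it gives
   [ell F Y <= 2 * ell F 0 + 2 * b], hence a mass of at least [expR (- (2 * c * b)) * Z0]. *)
have [Z0 /andP[Z00 _] Z0E] := integral_expRN pi0 D _ mD piD mell ell0.
pose b : R := n%:R^-1 * \sum_(j < K) \sum_(i < n) M ^+ 2.
pose B : R := 2 * tau * (2 * c * b - ln Z0).
(* An entry [x] of the estimator is within [1 + (x - y)^2 <= 1 + n * B] of the corresponding datum
   [y]; the last summand covers the spread. *)
exists (`|M| + 1 + n%:R * B + `|B|) => Y YM.
have bY : ell 0 Y <= b.
  rewrite ellE ler_wpM2l ?invr_ge0//.
  apply: ler_sum => j _; apply: ler_sum => i _; rewrite mxE sub0r sqrrN.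
  by rewrite -real_normK ?num_real// lerXn2r ?nnegrE// (le_trans _ (YM j i)).
have mB : - (2 * tau * ln (gibbs_mass pi0 tau D Y)) <= B.
  rewrite -mulrN ler_wpM2l ?mulr_ge0// ?(ltW tau0)// lerNl opprB.
  rewrite -ler_expR lnK ?posrE ?gibbs_mass_gt0// expRD lnK//.
  rewrite -lee_fin -(gibbs_massP pi0 tau tau0 D mD piD Y).2 mulrC EFinM -Z0E.
  rewrite -ge0_integralZl//.
  - apply: ge0_le_integral => //.
    + apply: measurable_funTS; apply: emeasurable_funM => //.
      apply/measurable_EFinP; apply: measurableT_comp => //.
      exact: measurable_funN.
    + apply/measurable_EFinP; apply: measurable_funTS.
      exact: measurable_gibbs_density.
    + move=> F _; rewrite -EFinM lee_fin -expRD ler_expR -/c.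
      have -> : - (2 * c * b) - 2 * c * ell F 0 = - (c * (2 * b + 2 * ell F 0)) by ring.
      rewrite lerN2 ler_wpM2l ?(ltW c0)//.
      apply: (@le_trans _ _ (2 * ell 0 Y + 2 * ell F 0)); last lra.
      rewrite !ellE !(mulrCA 2) -mulrDr ler_wpM2l ?invr_ge0//.
      rewrite !mulr_sumr -big_split; apply: ler_sum => j _ /=.
      rewrite !mulr_sumr -big_split; apply: ler_sum => i _ /=.
      by rewrite mxE; have := sqr_ge0 (F j i + Y j i); lra.
  - apply/measurable_EFinP; apply: measurable_funTS; apply: measurableT_comp => //.
    exact: measurable_funN.
have h := EWA_spread_le n0 pi0 tau tau0 D mD piD Y.
have e0 := ell_ge0 (EWA pi0 tau Y D) Y.
have s0 := gibbs_spread_ge0 pi0 tau D Y.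
have nB : 0 <= n%:R * B by rewrite mulr_ge0//; lra.
have MM := ler_norm M; have BB := ler_norm B; have M0 := normr_ge0 M.
split; last by lra.
move=> j i; have h1 := sqr_entry_le_ell (EWA pi0 tau Y D) Y j i n0.
have h2 : n%:R * ell (EWA pi0 tau Y D) Y <= n%:R * B by rewrite ler_wpM2l//; lra.
set x := EWA pi0 tau Y D j i in h1 *.
have h3 : `|x - Y j i| <= 1 + (x - Y j i) ^+ 2.
  rewrite -[X in _ <= 1 + X]real_normK ?num_real//.
  by have := sqr_ge0 (`|x - Y j i| - 2^-1); lra.
have := lerB_dist x (Y j i); have := YM j i; lra.
Qed.

End gibbs_bounds.

(** * Spectral norm and square root *)

Section spectral_bounds.
Context {R : realType}.

Lemma entry_le_mx_norm m n (A : 'M[R]_(m, n)) i j : `|A i j| <= `|A|.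
Proof.
have -> : `|A| = mx_norm A by [].
by rewrite mx_normrE; exact: (le_bigmax 0 (fun ij : _ * _ => `|A ij.1 ij.2|) (i, j)).
Qed.

Lemma frob_norm_ge0 m n (A : 'M[R]_(m, n)) : 0 <= frob_norm A.
Proof. exact: sqrtr_ge0. Qed.

Lemma frob_normZ m n a (A : 'M[R]_(m, n)) : frob_norm (a *: A) = `|a| * frob_norm A.
Proof.
rewrite /frob_norm -sqrtr_sqr -sqrtrM ?sqr_ge0//; congr Num.sqrt.
rewrite mulr_sumr; apply: eq_bigr => i _; rewrite mulr_sumr.
by apply: eq_bigr => j _; rewrite mxE exprMn.
Qed.

Lemma frob_norm0 m n : frob_norm (0 : 'M[R]_(m, n)) = 0.
Proof. by rewrite -[X in frob_norm X](scale0r 0) frob_normZ normr0 mul0r. Qed.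

Lemma sqr_entry_le_frob m n (A : 'M[R]_(m, n)) i j : A i j ^+ 2 <= frob_norm A ^+ 2.
Proof.
rewrite frob_norm_sqr (bigD1 i)//= (bigD1 j)//= -addrA lerDl.
by apply: addr_ge0; repeat (apply: sumr_ge0 => ? _); exact: sqr_ge0.
Qed.

Lemma frob_norm_eq0 m n (A : 'M[R]_(m, n)) : frob_norm A = 0 -> A = 0.
Proof.
move=> A0; apply/matrixP => i j; rewrite mxE; apply/eqP.
rewrite -sqrf_eq0 eq_le sqr_ge0 andbT.
by have := sqr_entry_le_frob _ _ A i j; rewrite A0 expr0n.
Qed.

(** Cauchy-Schwarz, from the nonnegative squared norm of [b *: A - a *: B] with [a], [b] the two
    norms. Zero norms are treated apart because the end of the argument divides by [2 * a * b]. *)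
Lemma ip_le_frob m n (A B : 'M[R]_(m, n)) : ip A B <= frob_norm A * frob_norm B.
Proof.
have [A0|A0] := eqVneq (frob_norm A) 0.
  rewrite A0 mul0r (frob_norm_eq0 _ _ _ A0) /ip big1// => i _.
  by rewrite big1// => j _; rewrite mxE mul0r.
have [B0|B0] := eqVneq (frob_norm B) 0.
  rewrite B0 mulr0 (frob_norm_eq0 _ _ _ B0) /ip big1// => i _.
  by rewrite big1// => j _; rewrite mxE mulr0.
set a := frob_norm A in A0 *; set b := frob_norm B in B0 *.
have a0 : 0 < a by rewrite lt_neqAle eq_sym A0 frob_norm_ge0.
have b0 : 0 < b by rewrite lt_neqAle eq_sym B0 frob_norm_ge0.
have : 0 <= \sum_i \sum_j (b * A i j - a * B i j) ^+ 2.
  by do 2 (apply: sumr_ge0 => ? _); exact: sqr_ge0.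
have -> : \sum_i \sum_j (b * A i j - a * B i j) ^+ 2 =
    b ^+ 2 * \sum_i \sum_j A i j ^+ 2 + a ^+ 2 * \sum_i \sum_j B i j ^+ 2
    - 2 * a * b * ip A B.
  rewrite !mulr_sumr -big_split -sumrB; apply: eq_bigr => i _ /=.
  rewrite !mulr_sumr -big_split -sumrB; apply: eq_bigr => j _ /=; ring.
rewrite -!frob_norm_sqr -/a -/b => h.
have ab : 0 < 2 * a * b by rewrite !mulr_gt0.
rewrite -(ler_pM2l ab) -subr_ge0; apply: (le_trans h).
rewrite le_eqVlt; apply/orP; left; apply/eqP; ring.
Qed.

Lemma frob_mulmx_le m n (A : 'M[R]_(m, n)) (u : 'cV[R]_n) :
  frob_norm (A *m u) <= spectral_norm A * frob_norm u.
Proof.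
(* [sup] bounds only sets that are bounded above; entries of a vector in the unit ball are at most
   1, so absolute row sums of [A] give a bound. *)
have hub : has_ubound [set frob_norm (A *m v) | v in [set v : 'cV[R]_n | frob_norm v <= 1]].
  exists (Num.sqrt (\sum_(i < m) \sum_(j < 1) (\sum_k `|A i k|) ^+ 2)) => _ [v /= v1 <-].
  rewrite ler_wsqrtr//; apply: ler_sum => i _; apply: ler_sum => j _.
  rewrite -[leLHS]real_normK ?num_real// lerXn2r ?nnegrE ?sumr_ge0//.
  rewrite mxE; apply: (le_trans (ler_norm_sum _ _ _)); apply: ler_sum => k _.
  rewrite normrM ler_piMr// -(@expr_le1 _ 2%N)// real_normK ?num_real//.
  apply: (le_trans (sqr_entry_le_frob _ _ v k j)).
  by rewrite expr_le1// frob_norm_ge0.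
have [u0|u0] := eqVneq (frob_norm u) 0.
  by rewrite u0 mulr0 (frob_norm_eq0 _ _ _ u0) mulmx0 frob_norm0.
have u_gt0 : 0 < frob_norm u by rewrite lt_neqAle eq_sym u0 frob_norm_ge0.
rewrite -ler_pdivrMr// mulrC.
have -> : (frob_norm u)^-1 * frob_norm (A *m u) = frob_norm (A *m ((frob_norm u)^-1 *: u)).
  by rewrite -scalemxAr frob_normZ ger0_norm// invr_ge0 ltW.
move/ub_le_sup : hub; apply; exists ((frob_norm u)^-1 *: u) => //=.
by rewrite frob_normZ ger0_norm ?invr_ge0 ?(ltW u_gt0)// mulVf.
Qed.

Lemma spectral_norm_ge0 m n (A : 'M[R]_(m, n)) : 0 <= spectral_norm A.
Proof.
rewrite /spectral_norm; have [hs|] := pselect (has_sup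
    [set frob_norm (A *m u) | u in [set u : 'cV[R]_n | frob_norm u <= 1]]).
  move/sup_upper_bound : hs; apply; exists 0; first by rewrite /= frob_norm0.
  by rewrite mulmx0 frob_norm0.
(* Without a supremum, [sup] takes the default value 0. *)
by move=> hs; rewrite sup_out.
Qed.

Variables (K : nat) (Sigma : 'M[R]_K).
Local Notation S := (sqrtmx Sigma).

Lemma sqrtmx_sym : S^T = S.
Proof.
by rewrite /sqrtmx; case: xgetP => [x _ [[-> _] _]|_]//; rewrite trmx0.
Qed.

(* This also holds for the default value 0 of sqrtmx, so the existence of the
   positive semidefinite square root is never needed. *)
Lemma frob_sqrtmx_le (u : 'cV[R]_K) :
  frob_norm (S *m u) ^+ 2 <= spectral_norm Sigma * frob_norm u ^+ 2.
Proof.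
have u0 : 0 <= spectral_norm Sigma * frob_norm u ^+ 2.
  by rewrite mulr_ge0 ?spectral_norm_ge0 ?sqr_ge0.
rewrite /sqrtmx; case: xgetP => [x _ [[xT _] xx]|_]; last first.
  by rewrite mul0mx frob_norm0 expr0n.
have -> : frob_norm (x *m u) ^+ 2 = ip u (Sigma *m u).
  have -> : frob_norm (x *m u) ^+ 2 = ((x *m u)^T *m (x *m u)) 0 0.
    rewrite frob_norm_sqr mxE; apply: eq_bigr => i _.
    by rewrite big_ord1 [in RHS]mxE expr2.
  rewrite trmx_mul xT mulmxA -(mulmxA u^T) xx -mulmxA mxE; apply: eq_bigr => i _.
  by rewrite big_ord1 [u^T _ _]mxE.
apply: (le_trans (ip_le_frob _ _ _ _)).
rewrite mulrC expr2 mulrA ler_wpM2r ?frob_norm_ge0//.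
exact: frob_mulmx_le.
Qed.

Lemma sum_sqrtmx_le n (A : 'M[R]_(K, n)) :
  \sum_j \sum_i (S *m A) j i ^+ 2 <= spectral_norm Sigma * \sum_j \sum_i A j i ^+ 2.
Proof.
rewrite exchange_big [X in _ * X]exchange_big/= mulr_sumr; apply: ler_sum => i _.
have := frob_sqrtmx_le (col i A); rewrite !frob_norm_sqr.
congr (_ <= _ * _); apply: eq_bigr => j _; rewrite big_ord1.
  by rewrite !mxE; congr (_ ^+ 2); apply: eq_bigr => k _; rewrite mxE.
by rewrite mxE.
Qed.

Lemma ip_sqrtmx n (F X : 'M[R]_(K, n)) : ip F (S *m X) = ip (S *m F) X.
Proof.
have ipE (A B : 'M[R]_(K, n)) : ip A B = \tr (A^T *m B).
  rewrite /mxtrace /ip exchange_big; apply: eq_bigr => i _; rewrite mxE.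
  by apply: eq_bigr => j _; rewrite mxE.
by rewrite !ipE trmx_mul sqrtmx_sym mulmxA.
Qed.

Lemma ip_delta n (F : 'M[R]_(K, n)) j i : ip F (delta_mx j i) = F j i.
Proof.
rewrite /ip (bigD1 j)//= (bigD1 i)//= mxE !eqxx mulr1 big1 => [|k ki]; last first.
  by rewrite mxE (negbTE ki) andbF mulr0.
rewrite addr0 big1 ?addr0// => l lj.
by rewrite big1// => k _; rewrite mxE (negbTE lj) mulr0.
Qed.

End spectral_bounds.

(** * Shifting the observation along one direction *)

Section more_integrals.
Context {R : realType} {d} {T : measurableType d}.

Lemma Rintegral_sum (mu : {measure set T -> \bar R}) D
    (I : Type) (s : seq I) (f : I -> T -> R) :
  measurable D -> (forall i, mu.-integrable D (EFin \o f i)) ->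
  mu.-integrable D (EFin \o (fun x => \sum_(i <- s) f i x)) /\
  \int[mu]_(x in D) \sum_(i <- s) f i x = \sum_(i <- s) \int[mu]_(x in D) f i x.
Proof.
move=> mD fi; elim: s => [|i s [ih1 ih2]].
  rewrite big_nil; split.
    by apply: eq_integrable (integrable0 mu D) => // x _; rewrite /= big_nil.
  by under eq_Rintegral do rewrite big_nil; rewrite /Rintegral integral0.
split.
  by apply: eq_integrable (integrableD mD (fi i) ih1) => // x _; rewrite /= big_cons.
under eq_Rintegral do rewrite big_cons.
by rewrite RintegralD// ih2 big_cons.
Qed.

Lemma Rintegral_dens (mu nu : probability T R) (h : T -> R) D (f : T -> R) :
  measurable_fun setT h -> (forall x, 0 <= h x) ->
  (forall A, measurable A -> nu A = \int[mu]_(x in A) (h x)%:E)%E ->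
  measurable D -> measurable_fun setT f ->
  \int[nu]_(x in D) f x = \int[mu]_(x in D) (f x * h x).
Proof.
move=> mh h0 nuE mD mf; have /measurable_EFinP mEf := mf.
rewrite /Rintegral integralE [in RHS]integralE; congr (fine (_ - _)).
  rewrite (integral_dens mu nu h)//; last exact: measurable_funepos.
  apply: eq_integral => x _; rewrite !funeposE/= -!EFin_max -EFinM.
  by rewrite maxr_pMl// mul0r.
rewrite (integral_dens mu nu h)//; last exact: measurable_funeneg.
apply: eq_integral => x _; rewrite !funenegE/= -!EFin_max -EFinM.
by rewrite maxr_pMl// mul0r mulNr.
Qed.

End more_integrals.

Section gibbs_tilt.
Context {R : realType} {K n : nat} (n0 : (0 < n)%N).
Variables (pi0 : probability 'M[R]_(K, n) R) (tau : R) (tau0 : 0 < tau).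
Variables (D : set 'M[R]_(K, n)) (mD : measurable D) (piD : pi0 D = 1%E).
Local Notation gibbs := (gibbs pi0 tau).
Local Notation Fhat Y := (EWA pi0 tau Y D).
Variable C : 'M[R]_(K, n).
Let h (F : 'M[R]_(K, n)) := ip F C.

Lemma measurable_ip : measurable_fun setT h.
Proof.
do 2 (apply: measurable_sum => ?); apply: measurable_funM => //.
exact: measurable_mx_entry.
Qed.

(** Shifting the data changes the loss by a function affine in [F], so the posterior is tilted by an
    exponential of [ip F C]; the terms free of [F] disappear in the normalization. *)
Lemma ell_shift (F Y : 'M[R]_(K, n)) x :
  ell F (Y - x *: C) =
  ell F Y + 2 * x / n%:R * (ip F C - ip Y C) + n%:R^-1 * x ^+ 2 * ip C C.
Proof.
have -> : ell F (Y - x *: C) = ell F Y + ell Y (Y - x *: C) +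
    2 / n%:R * ip (F - Y) (Y - (Y - x *: C)).
  exact: ell_split.
have ipZ (A : 'M[R]_(K, n)) : ip A (x *: C) = x * ip A C.
  rewrite /ip mulr_sumr; apply: eq_bigr => j _; rewrite mulr_sumr.
  by apply: eq_bigr => i _; rewrite mxE mulrCA.
have -> : ell Y (Y - x *: C) = n%:R^-1 * x ^+ 2 * ip C C.
  rewrite ellE -mulrA; congr (_ * _); rewrite mulr_sumr; apply: eq_bigr => j _.
  by rewrite mulr_sumr; apply: eq_bigr => i _; rewrite !mxE; ring.
rewrite opprB addrCA subrr addr0 ipZ ipC ipDr ipNr !(ipC C).
by ring.
Qed.

Variable L : R.
Hypothesis oscL : forall F F', D F -> D F' -> `|ip F C - ip F' C| <= L.

Lemma Rintegral_gibbs_shift Y x :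
  let a := x / (tau * n%:R) in
  \int[gibbs (Y - x *: C)]_(F in D) ip F C =
  (\int[gibbs Y]_(F in D) (ip F C * expR (- (a * ip F C)))) /
  (\int[gibbs Y]_(F in D) expR (- (a * ip F C))).
Proof.
move=> a; set Y0 := Y - x *: C.
have nN0 : n%:R != 0 :> R by rewrite pnatr_eq0 -lt0n.
have tauN0 : tau != 0 by rewrite gt_eqF.
(* [k] gathers the factors of the density ratio that do not depend on [F]; the remaining exponent
   has slope [a], that is [(2 * tau)^-1 * (2 * x / n)]. *)
pose k := expR (a * ip Y C - (2 * tau)^-1 * (n%:R^-1 * x ^+ 2 * ip C C)).
have densE F : gibbs_density tau Y0 F = k * (gibbs_density tau Y F * expR (- (a * h F))).
  rewrite /gibbs_density ell_shift /k -!expRD; congr expR; rewrite /h /a.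
  by field; rewrite nN0 tauN0.
have k0 : 0 < k by exact: expR_gt0.
clearbody k Y0.
have mM := gibbs_mass_gt0 pi0 tau tau0 D mD piD.
pose q := k * gibbs_mass pi0 tau D Y / gibbs_mass pi0 tau D Y0.
have q0 : 0 < q by rewrite divr_gt0 ?mulr_gt0.
have me : measurable_fun setT (fun F => q * expR (- (a * h F))).
  apply: measurable_funM => //; apply: measurableT_comp => //.
  by apply: measurable_funN; apply: measurable_funM => //; exact: measurable_ip.
have e0 F : 0 <= q * expR (- (a * h F)) by rewrite mulr_ge0 ?expR_ge0// ltW.
have md := measurable_gibbs_density tau Y.
have nuE A : measurable A ->
    (gibbs Y0 A = \int[gibbs Y]_(F in A) (q * expR (- (a * h F)))%:E)%E.
  move=> mA; rewrite (gibbsE pi0 tau tau0 D)//.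
  rewrite (ge0_integral_gibbs pi0 tau tau0 D mD piD)//; last exact/measurable_EFinP.
  rewrite -ge0_integralZl//.
  - apply: eq_integral => F _; rewrite densE -!EFinM; congr EFin.
    have [M1 M2] := (lt0r_neq0 (mM Y), lt0r_neq0 (mM Y0)).
    rewrite /q; move: M1 M2; move: (gibbs_mass _ _ _ Y) (gibbs_mass _ _ _ Y0).
    move: (gibbs_density _ _ _) (expR (- _)) (k) => r e k' a1 a2 M1 M2.
    by field; rewrite M1 M2.
  - apply: measurable_funTS; apply: emeasurable_funM; exact/measurable_EFinP.
  - by move=> F _; rewrite mule_ge0 ?lee_fin ?expR_ge0.
  - by rewrite lee_fin invr_ge0 ltW.
clearbody q.
have fE (u : 'M[R]_(K, n) -> R) : measurable_fun setT u ->
    \int[gibbs Y0]_(F in D) u F = \int[gibbs Y]_(F in D) (u F * (q * expR (- (a * h F)))).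
  by move=> mu; apply: Rintegral_dens.
have [i1 i2] := integrable_tilt (gibbs Y) D mD (gibbs1 pi0 tau tau0 D mD piD Y)
  h L measurable_ip oscL a.
have pull (u : 'M[R]_(K, n) -> R) : measurable_fun setT u ->
    (gibbs Y).-integrable D (EFin \o (fun F => u F * expR (- (a * h F)))) ->
    \int[gibbs Y0]_(F in D) u F = q * \int[gibbs Y]_(F in D) (u F * expR (- (a * h F))).
  move=> mu iu; rewrite -[RHS](RintegralZl _ mD iu).
  transitivity (\int[gibbs Y]_(F in D) (u F * (q * expR (- (a * h F))))).
    exact: fE.
  by apply: eq_Rintegral => F _; rewrite mulrCA.
(* The factor [q] is identified by integrating the constant 1: both posteriors have total mass 1,
   which forces [q * den = 1]. *)
pose den := \int[gibbs Y]_(F in D) expR (- (a * h F)).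
have den1 : 1 = q * den.
  have ione : (gibbs Y).-integrable D (EFin \o (fun F => cst 1 F * expR (- (a * h F)))).
    by apply: eq_integrable i1 => // F _; rewrite /= mul1r.
  have one0 : \int[gibbs Y0]_(F in D) cst 1 F = 1.
    exact: (Rintegral_prob1_cst (gibbs Y0) D mD (gibbs1 pi0 tau tau0 D mD piD Y0)).
  rewrite -[LHS]one0 (pull _ (measurable_cst _) ione); congr (_ * _).
  by apply: eq_Rintegral => F _; rewrite mul1r.
have den0 : den != 0.
  by apply/eqP => den0; move/eqP: den1; rewrite den0 mulr0 oner_eq0.
apply: (etrans (pull h measurable_ip i2)).
have qE : q = den^-1 by apply: (mulIf den0); rewrite -den1 mulVf.
by rewrite qE mulrC.
Qed.

(** This is [tilted_mean_le] under the posterior at [Y], with [a = x / (tau * n)], multiplied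
    through by [tau * n]; the shifted estimator is the tilted mean. *)
Lemma EWA_shift_le Y x :
  `|x| * L <= 2^-1 * (tau * n%:R) ->
  x * (ip (Fhat Y) C - ip (Fhat (Y - x *: C)) C) <=
  3 / 2 * x ^+ 2 / (tau * n%:R) *
    \int[gibbs Y]_(F in D) (ip F C - ip (Fhat Y) C) ^+ 2.
Proof.
move=> xL.
have tn0 : 0 < tau * n%:R by rewrite mulr_gt0// ltr0n.
have g1 Z := gibbs1 pi0 tau tau0 D mD piD Z.
have meanE Z : \int[gibbs Z]_(F in D) ip F C = ip (Fhat Z) C.
  by have [_ ->] := Rintegral_ip_mean n0 (gibbs Z) D mD (g1 Z) Z
    (integrable_ell_gibbs pi0 tau tau0 D mD piD Z) C.
pose a := x / (tau * n%:R).
have aL : `|a| * L <= 2^-1.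
  by rewrite normrM normfV (gtr0_norm tn0) mulrAC ler_pdivrMr.
have tilted (m t : R) : \int[gibbs Y]_(F in D) h F = m ->
    (\int[gibbs Y]_(F in D) (h F * expR (- (a * h F)))) /
      (\int[gibbs Y]_(F in D) expR (- (a * h F))) = t ->
    a * (m - t) <= 3 / 2 * a ^+ 2 * \int[gibbs Y]_(F in D) (h F - m) ^+ 2.
  move=> <- <-.
  exact: (tilted_mean_le (gibbs Y) D mD (g1 Y) h L measurable_ip oscL a aL).
have := tilted _ _ (meanE Y) (etrans (esym (Rintegral_gibbs_shift Y x)) (meanE _)).
rewrite /h.
rewrite -(ler_pM2l tn0); congr (_ <= _).
  by rewrite /a mulrA mulrCA divff ?mulr1// gt_eqF.
have nN0 : n%:R != 0 :> R by rewrite pnatr_eq0 -lt0n.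
have tauN0 : tau != 0 by rewrite gt_eqF.
by rewrite /a; field; rewrite nN0 tauN0.
Qed.

End gibbs_tilt.

(** * Invariance of the noise under sign flips *)

Section row_laws.
Context {R : realType} {d} {Omega : measurableType d} (P : probability Omega R).

Lemma eq_expectation_law d' (T : measurableType d') (Z1 Z2 : {RV P >-> T}) (f : T -> R) :
  (forall A, measurable A -> P (Z1 @^-1` A) = P (Z2 @^-1` A)) ->
  measurable_fun setT f ->
  P.-integrable setT (EFin \o (f \o Z1)) -> P.-integrable setT (EFin \o (f \o Z2)) ->
  (\int[P]_w (f (Z1 w))%:E = \int[P]_w (f (Z2 w))%:E)%E.
Proof.
move=> lawE mf i1 i2; have /measurable_EFinP mEf := mf.
have h1 := integral_pushforward (measurable_funPT Z1) mEf i1 measurableT.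
have h2 := integral_pushforward (measurable_funPT Z2) mEf i2 measurableT.
rewrite preimage_setT in h1 h2.
rewrite -[LHS]h1 -[RHS]h2.
by apply: eq_measure_integral => A mA _; exact: lawE.
Qed.

Lemma integrable_prob1 D (f : Omega -> R) :
  measurable D -> P D = 1%E -> measurable_fun setT f ->
  P.-integrable D (EFin \o f) -> P.-integrable setT (EFin \o f).
Proof.
move=> mD PD mf /integrableP[_ ifD]; have /measurable_EFinP mEf := mf.
apply/integrableP; split => //.
by rewrite -(integral_prob1 P D)//; exact: measurableT_comp.
Qed.

Variables (K n : nat).

Lemma measurable_row m l (j : 'I_m) : measurable_fun setT (@row R m l j).
Proof.
apply: measurable_mx => k i; under eq_fun do rewrite mxE.
exact: measurable_mx_entry.
Qed.

Definition row_box (B : 'I_K -> set 'rV[R]_n) : set 'M[R]_(K, n) :=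
  [set M | forall k, B k (row k M)].

Lemma measurable_row_box B : (forall k, measurable (B k)) -> measurable (row_box B).
Proof.
move=> mB; have -> : row_box B = \bigcap_(k in setT) (@row R K n k @^-1` B k).
  by apply/seteqP; split => M MB k; [move=> _|]; exact: MB.
apply: fin_bigcap_measurable => [|k _]; first exact: finite_finset.
by rewrite -[_ @^-1` _]setTI; exact: measurable_row.
Qed.

(** Boxes are closed under intersection and generate the sigma-algebra. They are taken with
    arbitrary measurable sets of rows because independence factors over rows and not over
    entries. *)
Lemma row_box_law_unique (Z1 Z2 : {RV P >-> 'M[R]_(K, n)}) :
  (forall B, (forall k, measurable (B k)) ->
     P (Z1 @^-1` row_box B) = P (Z2 @^-1` row_box B)) ->
  forall A, measurable A -> P (Z1 @^-1` A) = P (Z2 @^-1` A).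
Proof.
move=> boxE A mA.
pose G := [set A | exists2 B : 'I_K -> set 'rV[R]_n,
  (forall k, measurable (B k)) & A = row_box B].
have boxT : row_box (fun=> setT) = setT by apply/seteqP; split.
apply: (measure_unique G (fun=> setT) _ _ _ _ (distribution P Z1) (distribution P Z2)) => //.
- apply/seteqP; split => [E mE|]; last first.
    apply: smallest_sub; first exact: sigma_algebra_measurable.
    by move=> _ [B mB ->]; exact: measurable_row_box.
  apply: (mE) => //; split; first exact: smallest_sigma_algebra.
  move=> _ [j [i [B [mB ->]]]]; apply: sub_sigma_algebra.
  (* A condition on one entry is a box that constrains only its row. *)
  exists (fun k => if k == j then [set r : 'rV[R]_n | B (r 0 i)] else setT).
    move=> k; case: ifP => // _; rewrite -[X in measurable X]setTI.
    exact: (measurable_mx_entry 0 i).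
  apply/seteqP; split => M /=.
    by move=> MB k; case: eqP => // ->; rewrite /= mxE.
  by move=> /(_ j); rewrite eqxx /= mxE.
- move=> _ _ [B mB ->] [B' mB' ->]; exists (fun k => B k `&` B' k).
    by move=> k; exact: measurableI.
  apply/seteqP; split => M /=; first by move=> [MB MB'] k; split.
  by move=> MB; split => k; have [] := MB k.
- by move=> _; exists (fun=> setT).
- by rewrite bigcup_const//; exists 0%N.
- by move=> _ [B mB ->]; exact: boxE.
- by move=> _; rewrite -ge0_fin_numE ?fin_num_measure.
Qed.

Definition flip_entry (j : 'I_K) (i : 'I_n) (X : 'M[R]_(K, n)) : 'M[R]_(K, n) :=
  X - (2 * X j i) *: delta_mx j i.

Lemma measurable_flip_entry j i : measurable_fun setT (flip_entry j i).
Proof.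
apply: measurable_mx => k l; under eq_fun do rewrite !mxE.
apply: measurable_funB; first exact: measurable_mx_entry.
by do 2 apply: measurable_funM => //; exact: measurable_mx_entry.
Qed.

Variable X : {RV P >-> 'M[R]_(K, n)}.
Hypothesis hindep : mutually_independent P (fun (j : 'I_K) (w : Omega) => row j (X w)).
Hypothesis hsym : forall (j : 'I_K) (s : 'I_n -> bool),
  same_distribution P (fun w : Omega => \row_(i < n) ((-1) ^+ s i * X w j i))
                      (fun w : Omega => row j (X w)).

Lemma indep_row_box B : (forall k, measurable (B k)) ->
  P (X @^-1` row_box B) = (\prod_k P [set w | B k (row k (X w))])%E.
Proof.
move=> mB; have := hindep [set: 'I_K]%SET B mB.
rewrite (_ : \bigcap_(_ in _) _ = X @^-1` row_box B); last first.
  apply/seteqP; split => w /=; first by move=> h k; apply: (h k); rewrite /= inE.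
  by move=> h k _; exact: h.
by move=> ->; apply: eq_bigl => k; rewrite inE.
Qed.

(** The flip acts on row [j] by a sign vector and fixes the other rows, so the preimage of a box is
    a box. In the product given by independence only the factor of row [j] is affected, and [hsym]
    preserves it. *)
Lemma flip_entry_law j i A : measurable A ->
  P ((flip_entry j i \o X) @^-1` A) = P (X @^-1` A).
Proof.
have mZ : measurable_fun setT (flip_entry j i \o X).
  by apply: measurableT_comp; [exact: measurable_flip_entry|exact: measurable_funPT].
pose Zm := isMeasurableFun.Build _ _ _ _ _ mZ.
pose Z : {mfun Omega >-> 'M[R]_(K, n)} := HB.pack (flip_entry j i \o X) Zm.
apply: (row_box_law_unique Z X) => B mB.
pose phi (r : 'rV[R]_n) : 'rV[R]_n := \row_l ((-1) ^+ (l == i) * r 0 l).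
have mphi : measurable_fun setT phi.
  apply: measurable_mx => k l; under eq_fun do rewrite mxE.
  by apply: measurable_funM => //; exact: measurable_mx_entry.
pose B' k := if k == j then phi @^-1` B k else B k.
have mB' k : measurable (B' k).
  by rewrite /B'; case: ifP => // _; rewrite -[X in measurable X]setTI; exact: mphi.
have -> : Z @^-1` row_box B = X @^-1` row_box B'.
  have rowE w k : row k (Z w) = if k == j then phi (row k (X w)) else row k (X w).
    apply/rowP => l; case: (eqVneq k j) => [->|kj]; rewrite !mxE/= ?eqxx/=.
      by case: (eqVneq l i) => [->|li]; rewrite /= ?mulr1 ?mulr0 ?mulN1r ?subr0 ?mul1r//; ring.
    by rewrite (negbTE kj) mulr0 subr0.
  by apply/seteqP; split => w /= h k; have := h k; rewrite rowE /B'; case: (k == j).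
rewrite !indep_row_box//; apply: eq_bigr => k _.
rewrite /B'; case: eqVneq => // ->.
have := hsym j (fun l => l == i) (B j) (mB j).
rewrite /pushforward => <-; congr (P _); apply/seteqP; split => w /=.
  by congr (B j _); apply/rowP => l; rewrite !mxE.
by congr (B j _); apply/rowP => l; rewrite !mxE.
Qed.

(** By invariance of the law the expectation equals its opposite; it is finite, hence zero. *)
Lemma odd_entry_expectation0 j i (f : 'M[R]_(K, n) -> R) :
  measurable_fun setT f -> (forall M, f (flip_entry j i M) = - f M) ->
  P.-integrable setT (EFin \o (f \o X)) -> (\int[P]_w (f (X w))%:E = 0)%E.
Proof.
move=> mf fodd iX.
have mZ : measurable_fun setT (flip_entry j i \o X).
  by apply: measurableT_comp; [exact: measurable_flip_entry|exact: measurable_funPT].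
pose Zm := isMeasurableFun.Build _ _ _ _ _ mZ.
pose Z : {mfun Omega >-> 'M[R]_(K, n)} := HB.pack (flip_entry j i \o X) Zm.
have iN : P.-integrable setT (EFin \o (f \o Z)).
  have := integrableN iX; apply: eq_integrable => // w _ /=.
  by rewrite fodd.
have := @eq_expectation_law _ _ Z X f (@flip_entry_law j i) mf iN iX.
have -> : (\int[P]_w (f (Z w))%:E = - \int[P]_w (f (X w))%:E)%E.
  rewrite -integralN/=; first by apply: eq_integral => w _; rewrite /= fodd.
  exact: integrable_add_def.
have := integrable_fin_num measurableT iX; rewrite /= => /fineK <-.
move=> [] h; congr EFin; move: h; lra.
Qed.

End row_laws.

(** * The oracle inequality *)

Section oracle_inequality.
Context {R : realType} {K n : nat} (n0 : (0 < n)%N).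
Variables (pi0 : probability 'M[R]_(K, n) R) (tau : R) (tau0 : 0 < tau).
Variables (D : set 'M[R]_(K, n)) (mD : measurable D) (piD : pi0 D = 1%E).
Variables (Sigma : 'M[R]_K) (Fstar : 'M[R]_(K, n)) (B L : R) (B0 : 0 < B).
Local Notation S := (sqrtmx Sigma).
Local Notation gibbs := (gibbs pi0 tau).
Local Notation Fhat Y := (EWA pi0 tau Y D).
Local Notation V Y := (gibbs_spread pi0 tau D Y).
Hypothesis diamD : forall F F', D F -> D F' ->
  forall j i, `|(S *m F) j i - (S *m F') j i| <= L.
Hypothesis BL : 2 * B * L <= tau * n%:R.

Definition observation (X : 'M[R]_(K, n)) : 'M[R]_(K, n) := Fstar + S *m X.

(** The displacement of the observation under a unit change of the noise entry [(j, i)]. Since [S]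
    is symmetric, pairing with it reads off an entry of [S *m F]. *)
Definition direction j i : 'M[R]_(K, n) := S *m delta_mx j i.

Definition drop_entry j i (X : 'M[R]_(K, n)) := X - X j i *: delta_mx j i.

(* The estimator at drop_entry j i X does not see the sign of X j i, which makes
   this quantity odd in X j i; it is subtracted so that only a second order term
   in X j i remains. *)
Definition odd_part (m : 'M[R]_(K, n)) j i (X : 'M[R]_(K, n)) : R :=
  X j i * (ip (Fhat (observation (drop_entry j i X))) (direction j i) -
           ip m (direction j i)).

Lemma ip_direction F j i : ip F (direction j i) = (S *m F) j i.
Proof. by rewrite ip_sqrtmx ip_delta. Qed.

Lemma ip_noise (A X : 'M[R]_(K, n)) :
  ip A (S *m X) = \sum_j \sum_i X j i * ip A (direction j i).
Proof.
rewrite ip_sqrtmx; apply: eq_bigr => j _; apply: eq_bigr => i _.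
by rewrite ip_direction mulrC.
Qed.

Lemma observation_drop j i X :
  observation (drop_entry j i X) = observation X - X j i *: direction j i.
Proof. by rewrite /observation mulmxBr -scalemxAr addrA. Qed.

(** Under the integral, the sum is the squared Frobenius norm of [S *m (F - Fhat Y)], to which
    [sum_sqrtmx_le] applies pointwise. *)
Lemma sum_variance_le Y :
  \sum_j \sum_i \int[gibbs Y]_(F in D)
    (ip F (direction j i) - ip (Fhat Y) (direction j i)) ^+ 2
  <= spectral_norm Sigma * n%:R * V Y.
Proof.
have g1 := gibbs1 pi0 tau tau0 D mD piD Y.
have meanE C := Rintegral_ip_mean n0 (gibbs Y) D mD g1 Y
  (integrable_ell_gibbs pi0 tau tau0 D mD piD Y) C.
pose f j i F := (ip F (direction j i) - ip (Fhat Y) (direction j i)) ^+ 2.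
have mf j i : measurable_fun setT (f j i).
  by apply: measurable_funX; apply: measurable_funB => //; exact: measurable_ip.
have if_ j i : (gibbs Y).-integrable D (EFin \o f j i).
  apply: (@integrable_fin_prob _ _ _ _ _ _ (L ^+ 2)) => // F DF.
  have osc F1 F2 : D F1 -> D F2 ->
      `|ip F1 (direction j i) - ip F2 (direction j i)| <= L.
    by move=> D1 D2; rewrite !ip_direction; exact: diamD.
  have := dist_mean_osc (gibbs Y) D mD g1 _ L (measurable_ip _) osc F DF.
  rewrite (meanE _).2 => h; rewrite /f normrX lerXn2r ?nnegrE//.
  exact: le_trans h.
have s1 j := Rintegral_sum (gibbs Y) D _ (index_enum 'I_n) (f j) mD (if_ j).
have s2 := Rintegral_sum (gibbs Y) D _ (index_enum 'I_K) _ mD (fun j => (s1 j).1).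
have -> : \sum_j \sum_i \int[gibbs Y]_(F in D) f j i F =
    \int[gibbs Y]_(F in D) \sum_j \sum_i f j i F.
  by rewrite s2.2; apply: eq_bigr => j _; rewrite (s1 j).2.
have iV : (gibbs Y).-integrable D (EFin \o (fun F => ell (Fhat Y) F)).
  have [ii _] := gibbs_bias_variance n0 pi0 tau tau0 D mD piD Y (Fhat Y).
  by apply: eq_integrable ii => // F _; rewrite /= ellC.
rewrite -RintegralZl//; apply: le_Rintegral => //.
- exact: s2.1.
- exact: (integrableZl mD _ iV).
move=> F _.
have -> : \sum_j \sum_i f j i F = \sum_j \sum_i (S *m (F - Fhat Y)) j i ^+ 2.
  apply: eq_bigr => j _; apply: eq_bigr => i _.
  by rewrite /f !ip_direction mulmxBr !mxE.
apply: (le_trans (sum_sqrtmx_le _ _ _ _)).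
rewrite ellC ellE -mulrA mulVKf ?pnatr_eq0 -?lt0n// ler_wpM2l ?spectral_norm_ge0//.
by apply: ler_sum => j _; apply: ler_sum => i _; rewrite !mxE.
Qed.

Definition oracle_value (p : probability 'M[R]_(K, n) R) (kl : R) : R :=
  \int[p]_(F in D) ell F Fstar + 2 * tau * kl.

Lemma EWA_oracle_pointwise (p : probability 'M[R]_(K, n) R) (kl : R) (X : 'M[R]_(K, n)) :
  p D = 1%E -> (\int[p]_(F in D) (ell F Fstar)%:E < +oo)%E -> KL p pi0 = kl%:E ->
  (forall j i, `|X j i| <= B) ->
  ell (Fhat (observation X)) Fstar +
    (1 - 3 * B ^+ 2 * spectral_norm Sigma / (tau * n%:R)) * V (observation X) <=
  oracle_value p kl + 2 / n%:R * \sum_j \sum_i odd_part (mean p D) j i X.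
Proof.
(* Here [c] is the term quadratic in the noise, common to both sides, [q * s] and [q * u] are the
   two cross terms, and [w] is the variance of [p], which enters the losses to [Y] and to [Fstar]
   alike. *)
have collect (a v q s c w o k u : R) :
    a - q * s + c + v <= o - q * u + c + w + k -> a + v <= o + w + k + q * (s - u).
  by lra.
move=> pD pfin pkl XB; set Y := observation X; set m := mean p D.
have nN0 : n%:R != 0 :> R by rewrite pnatr_eq0 -lt0n.
have nn0 : 0 < n%:R :> R by rewrite ltr0n.
have tn0 : 0 < tau * n%:R by rewrite mulr_gt0.
have ip0 : p.-integrable D (fun F => (ell F Fstar)%:E) by exact: integrable_ell.
have [_ pstar] := bias_variance n0 p D mD pD Fstar ip0 Fstar.
have [ipY pY] := bias_variance n0 p D mD pD Fstar ip0 Y.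
have step1 : ell (Fhat Y) Y + V Y <= \int[p]_(F in D) ell F Y + 2 * tau * kl.
  apply: (le_trans (EWA_spread_le n0 pi0 tau tau0 D mD piD Y)).
  have := gibbs_variational pi0 tau tau0 D mD piD p Y pD.
  rewrite pkl -EFinM -[X in (_ <= X + _)%E]fineK ?integrable_fin_num//.
have step2 A : ell A Y =
    ell A Fstar - 2 / n%:R * ip (A - Fstar) (S *m X) + n%:R^-1 * ip (S *m X) (S *m X).
  have -> : ell A Y = ell A Fstar + ell Fstar Y + 2 / n%:R * ip (A - Fstar) (Fstar - Y).
    exact: ell_split.
  have -> : Fstar - Y = - (S *m X) by rewrite /Y /observation opprD addrA subrr add0r.
  have -> : ell Fstar Y = n%:R^-1 * ip (S *m X) (S *m X).
    rewrite ellE; congr (_ * _); apply: eq_bigr => j _; apply: eq_bigr => i _.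
    by rewrite /Y /observation mxE opprD addrA subrr add0r sqrrN expr2.
  by rewrite ipNr; ring.
have step3 : ell (Fhat Y) Fstar + V Y <=
    oracle_value p kl + 2 / n%:R * ip (Fhat Y - m) (S *m X).
  move: step1; rewrite pY !step2 /oracle_value pstar -/m.
  have -> : ip (Fhat Y - m) (S *m X) =
      ip (Fhat Y - Fstar) (S *m X) - ip (m - Fstar) (S *m X).
    by rewrite !(ipC _ (S *m X)) -ipNr -ipDr; congr ip; rewrite opprB addrA subrK.
  exact: collect.
pose var j i := \int[gibbs Y]_(F in D)
  (ip F (direction j i) - ip (Fhat Y) (direction j i)) ^+ 2.
(* The factor of [EWA_shift_le] at the largest noise value [B]; times [2 / n] and [||Sigma|| n] it
   becomes the coefficient of [V] in the statement. *)
pose q := 3 / 2 * B ^+ 2 / (tau * n%:R).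
have step4 j i : X j i * ip (Fhat Y - m) (direction j i) <= q * var j i + odd_part m j i X.
  have osc F1 F2 : D F1 -> D F2 ->
      `|ip F1 (direction j i) - ip F2 (direction j i)| <= L.
    by move=> D1 D2; rewrite !ip_direction; exact: diamD.
  have xL : `|X j i| * L <= 2^-1 * (tau * n%:R).
    (* A point of [D] gives [0 <= L], which allows multiplying [|X j i| <= B] by [L]. *)
    have [DF DFn] := prob1_nonempty pi0 D piD.
    have L0 : 0 <= L by rewrite (le_trans _ (osc _ _ DFn DFn)).
    by rewrite ler_pdivlMl// (le_trans _ BL)// -mulrA ler_pM2l// ler_wpM2r.
  have := EWA_shift_le n0 pi0 tau tau0 D mD piD (direction j i) L osc Y (X j i) xL.
  rewrite -/(var j i) => h.
  have var0 : 0 <= var j i by apply: Rintegral_ge0 => F _; exact: sqr_ge0.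
  have xB : X j i ^+ 2 <= B ^+ 2.
    by rewrite -real_normK ?num_real// lerXn2r ?nnegrE// ltW.
  have xq : 3 / 2 * X j i ^+ 2 / (tau * n%:R) <= q.
    by rewrite /q ler_pM2r ?invr_gt0// ler_pM2l// divr_gt0.
  have h2 := ler_wpM2r var0 xq.
  have ipB : ip (Fhat Y - m) (direction j i) =
      ip (Fhat Y) (direction j i) - ip m (direction j i).
    by rewrite !(ipC _ (direction j i)) -ipNr -ipDr.
  rewrite /odd_part observation_drop -/Y ipB.
  (* Subtracting [odd_part] cancels the mean [m] and leaves the difference between the estimators at
     [Y] and at the shifted data. *)
  rewrite -lerBlDr -mulrBr opprB addrA subrK.
  exact: le_trans h h2.
have step5 : ip (Fhat Y - m) (S *m X) <=
    q * (spectral_norm Sigma * n%:R * V Y) + \sum_j \sum_i odd_part m j i X.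
  rewrite ip_noise.
  apply: (@le_trans _ _ (q * (\sum_j \sum_i var j i) + \sum_j \sum_i odd_part m j i X)).
    rewrite mulr_sumr -big_split; apply: ler_sum => j _.
    by rewrite mulr_sumr -big_split; apply: ler_sum => i _; exact: step4.
  rewrite lerD2r ler_wpM2l//; last exact: sum_variance_le.
  by rewrite divr_ge0 ?(ltW tn0)// mulr_ge0 ?sqr_ge0// divr_ge0.
have step6 : 2 / n%:R * ip (Fhat Y - m) (S *m X) <=
   2 / n%:R * (q * (spectral_norm Sigma * n%:R * V Y) + \sum_j \sum_i odd_part m j i X).
  by rewrite ler_wpM2l// divr_ge0// ltW.
have qE : 2 / n%:R * (q * (spectral_norm Sigma * n%:R * V Y)) =
   3 * B ^+ 2 * spectral_norm Sigma / (tau * n%:R) * V Y.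
  by rewrite /q; field; rewrite nN0 gt_eqF.
rewrite mulrDr qE in step6; rewrite mulrBl mul1r addrA lerBlDr.
by apply: (le_trans step3); rewrite -[leRHS]addrA lerD2l [leRHS]addrC.
Qed.

End oracle_inequality.

(** * Expectation over the noise *)

Section expected_oracle_inequality.
Context {R : realType} {K n : nat} (n0 : (0 < n)%N).
Variables (pi0 : probability 'M[R]_(K, n) R) (tau : R) (tau0 : 0 < tau).
Variables (D : set 'M[R]_(K, n)) (mD : measurable D) (piD : pi0 D = 1%E).
Variables (Sigma : 'M[R]_K) (Fstar : 'M[R]_(K, n)) (B L : R) (B0 : 0 < B).
Local Notation S := (sqrtmx Sigma).
Local Notation Fhat Y := (EWA pi0 tau Y D).
Local Notation V Y := (gibbs_spread pi0 tau D Y).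
Local Notation observation := (observation Sigma Fstar).
Local Notation direction := (direction Sigma).
Local Notation odd_part := (odd_part pi0 tau D Sigma Fstar).
Local Notation drop_entry := (@drop_entry R K n).

Lemma measurable_mulmx m l q d (T : measurableType d) (A : 'M[R]_(m, l))
    (f : T -> 'M[R]_(l, q)) :
  measurable_fun setT f -> measurable_fun setT (fun x => A *m f x).
Proof.
move=> mf; apply: measurable_mx => j i; under eq_fun do rewrite mxE.
apply: measurable_sum => k; apply: measurable_funM => //.
exact: (measurableT_comp (measurable_mx_entry _ _)).
Qed.

Lemma measurable_observation : measurable_fun setT observation.
Proof.
have mS : measurable_fun setT (fun X : 'M[R]_(K, n) => S *m X).
  exact: measurable_mulmx.
apply: measurable_mx => j i; under eq_fun do rewrite mxE.
apply: measurable_funD => //.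
exact: (measurableT_comp (measurable_mx_entry j i) mS).
Qed.

Lemma measurable_odd_part m j i : measurable_fun setT (odd_part m j i).
Proof.
have mdrop : measurable_fun setT (drop_entry j i).
  apply: measurable_mx => k l; under eq_fun do rewrite !mxE.
  apply: measurable_funB; first exact: measurable_mx_entry.
  by apply: measurable_funM => //; exact: measurable_mx_entry.
have mY := measurableT_comp measurable_observation mdrop.
have mE := measurable_EWA pi0 tau tau0 D mD piD _ mY.
apply: measurable_funM; first exact: measurable_mx_entry.
apply: measurable_funB => //.
exact: (measurableT_comp (measurable_ip _) mE).
Qed.

Lemma odd_part_flip m j i (X : 'M[R]_(K, n)) :
  odd_part m j i (flip_entry K n j i X) = - odd_part m j i X.
Proof.
have fE : flip_entry K n j i X j i = - X j i.
  by rewrite !mxE !eqxx mulr1 mulr_natl mulr2n opprD addNKr.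
have dE : drop_entry j i (flip_entry K n j i X) = drop_entry j i X.
  rewrite /drop_entry fE /flip_entry scaleNr opprK -addrA; congr (_ + _).
  by rewrite mulr_natl mulr2n scalerDl opprD -addrA addNr addr0.
move: fE dE; move: (flip_entry K n j i X) => Xf fE dE.
by rewrite /odd_part dE fE mulNr.
Qed.

Lemma observation_bounded : exists M : R, forall X : 'M[R]_(K, n),
  (forall k l, `|X k l| <= B) -> forall k l, `|observation X k l| <= M.
Proof.
exists (\sum_k \sum_l `|Fstar k l| + \sum_k \sum_l `|S k l| * B) => X XB k l.
rewrite !mxE (le_trans (ler_normD _ _))// lerD//.
  rewrite (bigD1 k)//= (bigD1 l)//= -addrA lerDl.
  by apply: addr_ge0; repeat (apply: sumr_ge0 => ? _).
apply: (@le_trans _ _ (\sum_h `|S k h| * B)).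
  apply: (le_trans (ler_norm_sum _ _ _)).
  by apply: ler_sum => h _; rewrite normrM ler_wpM2l.
rewrite [leRHS](bigD1 k)//= lerDl.
by repeat (apply: sumr_ge0 => ? _); rewrite mulr_ge0// ltW.
Qed.

Lemma odd_part_bounded m j i : exists C : R, forall X : 'M[R]_(K, n),
  (forall k l, `|X k l| <= B) -> `|odd_part m j i X| <= C.
Proof.
have [M YM] := observation_bounded.
have [C EC] := EWA_bounded n0 pi0 tau tau0 D mD piD M.
pose T := \sum_k \sum_l C * `|direction j i k l|.
exists (B * (T + `|ip m (direction j i)|)) => X XB.
rewrite normrM ler_pM//.
rewrite (le_trans (ler_normB _ _))// lerD2r /ip.
apply: (le_trans (ler_norm_sum _ _ _)); apply: ler_sum => k _.
apply: (le_trans (ler_norm_sum _ _ _)); apply: ler_sum => l _.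
rewrite normrM ler_wpM2r//; apply: (EC _ _).1; apply: YM => k' l'.
(* The dropped entry becomes 0 and the others are kept, so the bound [B] survives. *)
rewrite !mxE; case: (eqVneq k' j) => [->|_]; case: (eqVneq l' i) => [->|_] /=;
  rewrite ?mulr1 ?mulr0 ?subrr ?subr0 ?normr0 ?XB// ltW//.
Qed.

Lemma spread_bounded : exists C : R, forall X : 'M[R]_(K, n),
  (forall k l, `|X k l| <= B) -> V (observation X) <= C.
Proof.
have [M YM] := observation_bounded.
have [C EC] := EWA_bounded n0 pi0 tau tau0 D mD piD M.
by exists C => X /YM /EC [].
Qed.

Hypothesis diamD : forall F F', D F -> D F' ->
  forall j i, `|(S *m F) j i - (S *m F') j i| <= L.
Hypothesis BL : 2 * B * L <= tau * n%:R.

Context {d} {Omega : measurableType d} (P : probability Omega R).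
Variable X : {RV P >-> 'M[R]_(K, n)}.
Hypothesis hindep : mutually_independent P (fun (j : 'I_K) (w : Omega) => row j (X w)).
Hypothesis hsym : forall (j : 'I_K) (s : 'I_n -> bool),
  same_distribution P (fun w : Omega => \row_(i < n) ((-1) ^+ s i * X w j i))
                      (fun w : Omega => row j (X w)).
Hypothesis hbounded : forall (i : 'I_n) (j : 'I_K),
  P [set w : Omega | `|X w j i| <= B] = 1%E.

(** The deterministic bounds hold only on this event of probability 1, so integrals over [Omega] are
    carried over to it and back. *)
Let box : set Omega := [set w | forall j i, `|X w j i| <= B].

Let mbox1 j i : measurable [set w | `|X w j i| <= B].
Proof.
have h : measurable_fun setT (fun w => `|X w j i|%:E).
  apply/measurable_EFinP; apply: measurableT_comp => //.
  exact: (measurableT_comp (measurable_mx_entry j i) (measurable_funPT X)).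
have := emeasurable_fun_infty_c measurableT h B%:E.
by rewrite setTI.
Qed.

Let mbox : measurable box.
Proof.
have -> : box = \bigcap_(z in [set: 'I_K * 'I_n]) [set w | `|X w z.1 z.2| <= B].
  apply/seteqP; split => w; first by move=> h z _; exact: h.
  by move=> h j i; exact: (h (j, i)).
by apply: fin_bigcap_measurable => [|z _]; [exact: finite_finset|exact: mbox1].
Qed.

Let Pbox : P box = 1%E.
Proof.
have null j i : P.-negligible (~` [set w | `|X w j i| <= B]).
  exists (~` [set w | `|X w j i| <= B]); split => //; first exact: measurableC.
  by rewrite probability_setC// hbounded subee.
have : P (~` box) = 0%E.
  have [N [mN N0 sN]] : \forall w \ae P, forall z : 'I_K * 'I_n, `|X w z.1 z.2| <= B.
    by apply: filter_forall => z; exact: null.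
  apply/eqP; rewrite -measure_le0 -N0 le_measure ?inE//; first exact: measurableC.
  by move=> w nb; apply: sN => /= h; apply: nb => j i; exact: (h (j, i)).
rewrite probability_setC// -(fineK (fin_num_measure P _ mbox)) -EFinB.
by case=> /eqP; rewrite subr_eq0 => /eqP <-.
Qed.

Let odd_int m j i :
  P.-integrable setT (EFin \o (odd_part m j i \o X)) /\
  \int[P]_w (odd_part m j i \o X) w = 0.
Proof.
have mo : measurable_fun setT (odd_part m j i) by exact: measurable_odd_part.
have [C oC] := odd_part_bounded m j i.
have moX := measurableT_comp mo (measurable_funPT X).
have ib := integrable_fin_prob P box _ C mbox moX (fun w wb => oC (X w) wb).
have io := integrable_prob1 P box _ mbox Pbox moX ib.
split; first exact: io.
have -> : (\int[P]_w (odd_part m j i \o X) w = fine 0%E)%R; last by [].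
congr fine; apply: (odd_entry_expectation0 P K n X hindep hsym j i _ mo) io => M.
exact: odd_part_flip.
Qed.

(** In the extended reals, a term can be moved across an inequality only once it is known to be
    finite; the second bound of the theorem needs this. *)
Lemma EWA_spread_integrable :
  (\int[P]_w (V (observation (X w)))%:E < +oo)%E.
Proof.
have mV : measurable_fun setT (fun w => V (observation (X w))).
  apply: measurable_gibbs_spread => //.
  exact: (measurableT_comp measurable_observation).
have [C VC] := spread_bounded.
rewrite -(integral_prob1 P box)//; last exact/measurable_EFinP.
apply: (@le_lt_trans _ _ (\int[P]_(w in box) cst C%:E w)%E).
  apply: ge0_le_integral => //.
  - by move=> w _; rewrite lee_fin; exact: gibbs_spread_ge0.
  - by apply/measurable_EFinP; exact: measurable_funTS.
  - by move=> w wb; rewrite lee_fin; exact: VC.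
by rewrite integral_cst//; have /= -> := Pbox; rewrite mule1 ltry.
Qed.

Lemma expected_EWA_le (c : R) (p : probability 'M[R]_(K, n) R) (kl : R) :
  0 <= c -> c <= 1 - 3 * B ^+ 2 * spectral_norm Sigma / (tau * n%:R) ->
  p D = 1%E -> (\int[p]_(F in D) (ell F Fstar)%:E < +oo)%E -> KL p pi0 = kl%:E ->
  (\int[P]_w (ell (Fhat (observation (X w))) Fstar)%:E +
     c%:E * \int[P]_w (V (observation (X w)))%:E <=
   (oracle_value tau D Fstar p kl)%:E)%E.
Proof.
move=> c0 cle pD pfin pkl; set m := mean p D.
have mobs := measurableT_comp measurable_observation (measurable_funPT X).
have mV : measurable_fun setT (fun w => V (observation (X w))).
  exact: measurable_gibbs_spread.
have mE : measurable_fun setT (fun w => ell (Fhat (observation (X w))) Fstar).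
  by apply: measurable_ell => //; exact: measurable_EWA.
have V0 w : 0 <= V (observation (X w)) by exact: gibbs_spread_ge0.
have /measurable_EFinP mEV := mV; have /measurable_EFinP mEE := mE.
rewrite -ge0_integralZl//; last by move=> w _; rewrite lee_fin.
rewrite -ge0_integralD//; last 3 first.
- by move=> w _; rewrite lee_fin ell_ge0.
- by move=> w _; rewrite mule_ge0 ?lee_fin.
- exact: emeasurable_funM.
rewrite -(integral_prob1 P box)//; last first.
  by apply: emeasurable_funD => //; exact: emeasurable_funM.
pose rhs w := oracle_value tau D Fstar p kl +
  2 / n%:R * \sum_j \sum_i (odd_part m j i \o X) w.
have s1 j := Rintegral_sum P setT _ (index_enum 'I_n) _ measurableT
  (fun i => (odd_int m j i).1).
have s2 := Rintegral_sum P setT _ (index_enum 'I_K) _ measurableT (fun j => (s1 j).1).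
have ic := finite_measure_integrable_cst P (oracle_value tau D Fstar p kl) measurableT.
have irhs : P.-integrable setT (EFin \o rhs).
  exact: (integrableD measurableT ic (integrableZl measurableT (2 / n%:R) s2.1)).
have rhsE : \int[P]_w rhs w = oracle_value tau D Fstar p kl.
  rewrite /rhs RintegralD//; last exact: (integrableZl measurableT (2 / n%:R) s2.1).
  rewrite RintegralZl//; last exact: s2.1.
  rewrite s2.2 big1 ?mulr0 ?addr0.
    by rewrite Rintegral_prob1_cst//; exact: probability_setT.
  move=> j _; rewrite (s1 j).2 big1// => i _; exact: (odd_int m j i).2.
(* Because [0 <= c], the left integrand is nonnegative, and monotonicity of nonnegative integrals
   applies on [box], where the pointwise inequality holds. *)
apply: (@le_trans _ _ (\int[P]_(w in box) (rhs w)%:E)%E).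
  apply: ge0_le_integral => //.
  - by move=> w _; rewrite adde_ge0 ?mule_ge0 ?lee_fin ?ell_ge0.
  - by apply: measurable_funTS; apply: emeasurable_funD => //; exact: emeasurable_funM.
  - exact: (measurable_funTS (measurable_int P irhs)).
  - move=> w wb; rewrite -EFinM -EFinD lee_fin.
    have h := EWA_oracle_pointwise n0 pi0 tau tau0 D mD piD Sigma Fstar B L
      B0 diamD BL p kl (X w) pD pfin pkl wb.
    apply: le_trans h; rewrite lerD2l; exact: ler_wpM2r.
rewrite (integral_prob1 P box)//; last exact: (measurable_int P irhs).
rewrite -[X in (X <= _)%E]fineK; last exact: (integrable_fin_num measurableT irhs).
by rewrite lee_fin -[leRHS]rhsE.
Qed.

End expected_oracle_inequality.

(* The theorem is the case (c, k) = (0, 3), followed by (c, k) = (1 / 2, 6). *)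
Lemma EWA_oracle_inequality (R : realType) (n K : nat) (n0 : (0 < n)%N)
    (d : measure_display) (Omega : measurableType d) (P : probability Omega R)
    (Fstar : 'M[R]_(K, n)) (calF : set 'M[R]_(K, n)) (mF : measurable calF)
    (pi0 : probability 'M[R]_(K, n) R) (hpi0 : pi0 calF = 1%E)
    (Sigma : 'M[R]_K) (X : {RV P >-> 'M[R]_(K, n)})
    (hindep : mutually_independent P (fun (j : 'I_K) (w : Omega) => row j (X w)))
    (B : R) (B0 : 0 < B)
    (hbounded : forall (i : 'I_n) (j : 'I_K), P [set w : Omega | `|X w j i| <= B] = 1%E)
    (hsym : forall (j : 'I_K) (s : 'I_n -> bool),
       same_distribution P
         (fun w : Omega => \row_(i < n) ((-1) ^+ s i * X w j i))
         (fun w : Omega => row j (X w)))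
    (L : R)
    (hdiam : forall F F' : 'M[R]_(K, n), calF F -> calF F' ->
       \big[Num.max/0]_(i < n) `|sqrtmx Sigma *m (col i F - col i F')| <= L)
    (tau c k : R) (tau0 : 0 < tau) (c0 : 0 <= c) (ck : c * k <= k - 3) (k0 : 0 < k)
    (htau : n%:R^-1 * B * Num.max (2 * L) (k * spectral_norm Sigma * B) <= tau) :
  (\int[P]_w (ell
       (EWA pi0 tau (observation Sigma Fstar (X w)) calF) Fstar)%:E +
     c%:E * \int[P]_w (gibbs_spread pi0 tau calF (observation Sigma Fstar (X w)))%:E <=
   oracle_risk calF pi0 tau Fstar)%E.
Proof.
have nn0 : 0 < n%:R :> R by rewrite ltr0n.
have htau' : B * Num.max (2 * L) (k * spectral_norm Sigma * B) <= tau * n%:R.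
  by move: htau; rewrite -mulrA mulrC ler_pdivrMr.
have BL : 2 * B * L <= tau * n%:R.
  apply: le_trans htau'; rewrite -mulrA mulrCA ler_wpM2l ?(ltW B0)//.
  by rewrite le_max lexx.
have BS : k * (B ^+ 2 * spectral_norm Sigma) <= tau * n%:R.
  apply: le_trans htau'.
  have -> : k * (B ^+ 2 * spectral_norm Sigma) = B * (k * spectral_norm Sigma * B) by ring.
  by rewrite ler_wpM2l ?(ltW B0)// le_max lexx orbT.
(* The hypothesis [ck] says [c <= 1 - 3 / k], and the temperature condition says that the quantity
   multiplied by 3 is at most [1 / k]. *)
have cle : c <= 1 - 3 * B ^+ 2 * spectral_norm Sigma / (tau * n%:R).
  have s0 : 0 <= B ^+ 2 * spectral_norm Sigma / (tau * n%:R).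
    apply: divr_ge0; last by rewrite mulr_ge0 ?(ltW tau0) ?(ltW nn0).
    by rewrite mulr_ge0 ?sqr_ge0 ?spectral_norm_ge0.
  have s1 : k * (B ^+ 2 * spectral_norm Sigma / (tau * n%:R)) <= 1.
    by rewrite mulrA ler_pdivrMr ?mul1r// mulr_gt0.
  have -> : 3 * B ^+ 2 * spectral_norm Sigma / (tau * n%:R) =
      3 * (B ^+ 2 * spectral_norm Sigma / (tau * n%:R)) by rewrite !mulrA.
  move: s0 s1; move: (B ^+ 2 * spectral_norm Sigma / (tau * n%:R)) => s s0 s1.
  rewrite -(ler_pM2l k0) mulrC.
  have : k * (3 * s) <= 3 by rewrite mulrCA ler_piMr.
  by lra.
have diamD F F' : calF F -> calF F' ->
    forall j i, `|(sqrtmx Sigma *m F) j i - (sqrtmx Sigma *m F') j i| <= L.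
  move=> DF DF' j i; apply: le_trans (hdiam _ _ DF DF').
  apply: le_trans (le_bigmax 0 (fun i => `|sqrtmx Sigma *m (col i F - col i F')|) i).
  (* The norm of a column vector here is its largest absolute entry. *)
  apply: le_trans (entry_le_mx_norm _ _ _ j 0).
  have colE (G : 'M[R]_(K, n)) : (sqrtmx Sigma *m col i G) j 0 = (sqrtmx Sigma *m G) j i.
    by rewrite !mxE; apply: eq_bigr => l _; rewrite mxE.
  rewrite mulmxBr [leRHS](_ : _ = `|(sqrtmx Sigma *m F) j i - (sqrtmx Sigma *m F') j i|)//.
  by rewrite [in LHS]mxE [X in _ + X]mxE !colE.
apply: le_ereal_inf_tmp => _ [p /= pD <-].
have ell0 : (0 <= \int[p]_(F in calF) (ell F Fstar)%:E)%E.
  by apply: integral_ge0 => F _; rewrite lee_fin ell_ge0.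
have KL0 := KL_ge0 p pi0.
have t2 : (0 < (2 * tau)%:E)%E by rewrite lte_fin mulr_gt0.
(* If the loss or the divergence of [p] is infinite, its value in the infimum is [+oo]; the
   real-valued argument covers the rest. *)
have [elloo|ellfin] := eqVneq (\int[p]_(F in calF) (ell F Fstar)%:E)%E +oo%E.
  rewrite elloo addye ?leey// gt_eqF// (lt_le_trans (ltNyr 0))//.
  by rewrite mule_ge0// ltW.
have [KLoo|KLfin] := eqVneq (KL p pi0) +oo%E.
  rewrite KLoo gt0_muley// addey ?leey// gt_eqF// (lt_le_trans (ltNyr 0))//.
have KLE : KL p pi0 = (fine (KL p pi0))%:E by rewrite fineK// ge0_fin_numE// ltey.
have ellE' : (\int[p]_(F in calF) (ell F Fstar)%:E < +oo)%E by rewrite ltey.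
have h := expected_EWA_le n0 pi0 tau tau0 calF mF hpi0 Sigma Fstar B L B0 diamD BL
  P X hindep hsym hbounded c p _ c0 cle pD ellE' KLE.
apply: (le_trans h).
rewrite /oracle_value EFinD EFinM -KLE fineK// ge0_fin_numE//.
Qed.

Theorem theorem2 (R : realType) (n K : nat) (hn : (1 <= n)%N) (hK : (1 <= K)%N)
    (d : measure_display) (Omega : measurableType d) (P : probability Omega R)
    (Fstar : 'M[R]_(K, n))
    (xi Y : {RV P >-> 'M[R]_(K, n)})
    (hY : forall w : Omega, Y w = Fstar + xi w)
    (calF : set 'M[R]_(K, n)) (mF : measurable calF)
    (pi0 : probability 'M[R]_(K, n) R) (hpi0 : pi0 calF = 1%E)
    (Sigma : 'M[R]_K) (hSigma : psdmx Sigma)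
    (xibar : {RV P >-> 'M[R]_(K, n)})
    (hxi : forall w : Omega, xi w = sqrtmx Sigma *m xibar w)
    (hindep : mutually_independent P
                (fun (j : 'I_K) (w : Omega) => row j (xibar w)))
    (Bxi : R) (hBxi : 0 < Bxi)
    (hbounded : forall (i : 'I_n) (j : 'I_K),
       P [set w : Omega | `|xibar w j i| <= Bxi] = 1%E)
    (hsym : forall (j : 'I_K) (s : 'I_n -> bool),
       same_distribution P
         (fun w : Omega => \row_(i < n) ((-1) ^+ s i * xibar w j i))
         (fun w : Omega => row j (xibar w)))
    (L : R) (hL : 0 < L)
    (hdiam : forall F F' : 'M[R]_(K, n), calF F -> calF F' ->
       \big[Num.max/0]_(i < n)
         `|sqrtmx Sigma *m (col i F - col i F')| <= L) :
  (forall tau : R, 0 < tau ->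
     n%:R^-1 * Bxi * Num.max (2 * L) (3 * spectral_norm Sigma * Bxi) <= tau ->
     ('E_P[fun w => ell (EWA pi0 tau (Y w) calF) Fstar]
        <= oracle_risk calF pi0 tau Fstar)%E)
  /\
  (forall tau : R, 0 < tau ->
     n%:R^-1 * Bxi * Num.max (2 * L) (6 * spectral_norm Sigma * Bxi) <= tau ->
     ('E_P[fun w => ell (EWA pi0 tau (Y w) calF) Fstar]
        <= oracle_risk calF pi0 tau Fstar
           - (2^-1)%:E *
             \int[P]_w \int[gibbs pi0 tau (Y w)]_(F in calF)
               (ell (EWA pi0 tau (Y w) calF) F)%:E)%E).
Proof.
have YE w : Y w = observation Sigma Fstar (xibar w) by rewrite hY hxi.
have spreadE tau (tau0 : 0 < tau) w :
    (\int[gibbs pi0 tau (Y w)]_(F in calF) (ell (EWA pi0 tau (Y w) calF) F)%:E)%E =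
    (gibbs_spread pi0 tau calF (observation Sigma Fstar (xibar w)))%:E.
  by rewrite YE; exact: EFin_gibbs_spread.
have ellE' tau : (\int[P]_w (ell (EWA pi0 tau (Y w) calF) Fstar)%:E =
    \int[P]_w (ell (EWA pi0 tau (observation Sigma Fstar (xibar w)) calF) Fstar)%:E)%E.
  by apply: eq_integral => w _; rewrite YE.
have aux := @EWA_oracle_inequality R n K hn d Omega P Fstar calF mF pi0 hpi0 Sigma xibar
  hindep Bxi hBxi hbounded hsym L hdiam.
split=> tau tau0 htau; rewrite unlock ellE'.
  have c3 : 0 * 3 <= 3 - 3 :> R by rewrite mul0r subrr.
  have := aux tau 0 3 tau0 (lexx _) c3 (ltr0n _ 3) htau.
  by rewrite mul0e adde0.
have c6 : 2^-1 * 6 <= 6 - 3 :> R by lra.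
have c0 : 0 <= 2^-1 :> R by rewrite invr_ge0.
have h := aux tau 2^-1 6 tau0 c0 c6 (ltr0n _ 6) htau.
have fin : (\int[P]_w (gibbs_spread pi0 tau calF
    (observation Sigma Fstar (xibar w)))%:E)%E \is a fin_num.
  rewrite ge0_fin_numE; last first.
    by apply: integral_ge0 => w _; rewrite lee_fin gibbs_spread_ge0.
  exact: (EWA_spread_integrable hn pi0 tau tau0 calF mF hpi0 Sigma Fstar
    Bxi hBxi P xibar hbounded).
have -> : (\int[P]_w \int[gibbs pi0 tau (Y w)]_(F in calF)
      (ell (EWA pi0 tau (Y w) calF) F)%:E =
    \int[P]_w (gibbs_spread pi0 tau calF (observation Sigma Fstar (xibar w)))%:E)%E.
  by apply: eq_integral => w _; exact: spreadE.
by rewrite leeBrDr ?fin_numM.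
Qed.
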